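(* Let $w, y \in \mathrm{CFC}(A_n)$ be cyclically fully commutative elements of the Coxeter group $W(A_n)$. Then $w$ and $y$ are conjugate in $W(A_n)$ if and only if their cylindrical heaps $\hat{H}(w)$ and $\hat{H}(y)$ are ring equivalent.
   Context: **The group.** $W(A_n)$ is the Coxeter group with generating set $S=\{s_1,\dots,s_n\}$ and relations $s_i^2=e$, $s_is_j=s_js_i$ for $|i-j|>1$, and $s_is_js_i=s_js_is_j$ for $|i-j|=1$ (it is isomorphic to the symmetric group $S_{n+1}$ via $s_i\mapsto (i\ i+1)$). **Expressions, FC and CFC.** An expression for $w$ is a word in $S$ whose product is $w$; it is reduced if it has minimal length among expressions for $w$. An element is fully commutative (FC) if any two of its reduced expressions differ by a sequence of commutations $s_is_j\mapsto s_js_i$ with $|i-j|>1$. A cyclic shift of a word is obtained by moving its first letter to the end, $s_{x_1}s_{x_2}\cdots s_{x_k}\mapsto s_{x_2}\cdots s_{x_k}s_{x_1}$, and iterating this move; the cyclic shifts of a word are all its rotations. An element $w$ is cyclically fully commutative (CFC) if every cyclic shift of every reduced expression for $w$ is a reduced expression for an FC element. $\mathrm{CFC}(A_n)$ is the set of CFC elements of $W(A_n)$. **Heaps.** The heap of a reduced expression $s_{x_1}\cdots s_{x_k}$ is the poset on $\{1,\dots,k\}$ whose order $\prec$ is the transitive closure of: $j\prec i$ if $i<j$ and $s_{x_i}$, $s_{x_j}$ do not commute (it follows that also $j \prec i$ whenever $i<j$ and $s_{x_i}=s_{x_j}$), with element $i$ labeled by $s_{x_i}$ (or $x_i$). Elements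 of a heap are called blocks; letters further left are higher in the heap. Heaps are considered up to isomorphism of labeled posets. All reduced expressions of an FC element $w$ have the same heap, denoted $H(w)$. **Cylindrical heaps.** If $w$ is CFC and has a reduced expression of the form $s_i\mathsf{u}$, the cyclic shift of $H(w)$ with respect to $i$ is the heap of $\mathsf{u}s_i$ (remove a block labeled $i$ from the top and append it to the bottom). Two heaps of CFC elements are cyclically equivalent if they differ by a sequence of cyclic shifts. The cylindrical heap $\hat{H}(w)$ is the equivalence class of heaps cyclically equivalent to $H(w)$. **Chunks and rings.** For $w\in \mathrm{CFC}(A_n)$, a chunk of size $m$ of $H(w)$ is a convex subheap of $H(w)$ consisting of $m$ blocks that corresponds to a maximal connected component of the Hasse diagram of $H(w)$. Two chunks are chunk equivalent if they differ by a sequence of cyclic shifts; the equivalence class $\hat{C}$ of a chunk $C$ is called a ring. All members of a ring have the same blocks (labels), and the number of blocks of the ring is the size of any chunk representing it. The cylindrical heap $\hat{H}(w)$ is regarded as the disjoint union of the rings $\hat C$, one for each chunk $C$ of $H(w)$. **Ring equivalence.** Suppose $\hat{H}(w)$ and $\hat{H}(w')$ consist exactly of the rings $R_1,\dots,R_k$ and $R'_1,\dots,R'_k$, respectively. They are ring equivalent if there is a bijection $R_i\leftrightarrow R'_i$ (between the two collections of rings) such that corresponding rings consist of the same number of blocks (not necessarily with the same labels). *)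

(* Defs.v *)
From HB Require Import structures.
From Stdlib Require Import Relation_Operators.
From mathcomp Require Import all_boot.
From mathcomp Require Import boolp classical_sets functions.

Set Implicit Arguments.
Unset Strict Implicit.
Unset Printing Implicit Defensive.

(* The generators s_1, ..., s_n of W(A_n) are indexed from 0:
   i : 'I_n stands for s_(i+1), and words in S are sequences over 'I_n. *)

Definition far n (i j : 'I_n) : bool := (i.+1 < j) || (j.+1 < i).
Definition near n (i j : 'I_n) : bool := (i.+1 == j) || (j.+1 == i).

Inductive in_context n (r : seq 'I_n -> seq 'I_n -> Prop) :
    seq 'I_n -> seq 'I_n -> Prop :=
  InContext u v x y : r x y -> in_context r (u ++ x ++ v) (u ++ y ++ v).

Inductive cox_relation n : seq 'I_n -> seq 'I_n -> Prop :=
| CoxSquare i : cox_relation [:: i; i] [::]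
| CoxComm i j : far i j -> cox_relation [:: i; j] [:: j; i]
| CoxBraid i j : near i j -> cox_relation [:: i; j; i] [:: j; i; j].

Definition cox_eq n : seq 'I_n -> seq 'I_n -> Prop :=
  clos_refl_sym_trans _ (in_context (@cox_relation n)).

Definition cox_eqb n (x y : seq 'I_n) : bool := `[< cox_eq x y >].

Lemma cox_eqb_refl n : reflexive (@cox_eqb n).
Proof. by move=> x; apply/asboolP/rst_refl. Qed.

Lemma cox_eqb_sym n : symmetric (@cox_eqb n).
Proof. by move=> x y; apply/asboolP/asboolP => h; apply: rst_sym. Qed.

Lemma cox_eqb_trans n : transitive (@cox_eqb n).
Proof.
by move=> y x z /asboolP xy /asboolP yz; apply/asboolP; apply: rst_trans yz.
Qed.

Canonical cox_equiv n :=
  EquivRel (@cox_eqb n) (@cox_eqb_refl n) (@cox_eqb_sym n) (@cox_eqb_trans n).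

Lemma cox_eq_cat n (x x' y y' : seq 'I_n) :
  cox_eq x x' -> cox_eq y y' -> cox_eq (x ++ y) (x' ++ y').
Proof.
move=> xx' yy'; apply: (@rst_trans _ _ _ (x' ++ y)).
  elim: xx' => {x x'} [_ _ [u v x x' r]|x|x x' _|x z x' _ IH1 _ IH2].
  - by apply: rst_step; rewrite -!catA; apply: InContext.
  - exact: rst_refl.
  - exact: rst_sym.
  - exact: rst_trans IH1 IH2.
elim: yy' => {y y'} [_ _ [u v y y' r]|y|y y' _|y z y' _ IH1 _ IH2].
- by apply: rst_step; rewrite !(catA x'); apply: InContext.
- exact: rst_refl.
- exact: rst_sym.
- exact: rst_trans IH1 IH2.
Qed.

Lemma cox_eq_rev n (x y : seq 'I_n) : cox_eq x y -> cox_eq (rev x) (rev y).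
Proof.
elim=> {x y} [_ _ [u v x y r]|x|x y _|x z y _ IH1 _ IH2].
- rewrite !rev_cat -!catA; apply: rst_step; apply: InContext.
  case: r => [i|i j ij|i j ij]; rewrite /rev /=; constructor => //.
  by rewrite /far orbC.
- exact: rst_refl.
- exact: rst_sym.
- exact: rst_trans IH1 IH2.
Qed.

Lemma cox_eq_rev_cat n (x : seq 'I_n) : cox_eq (rev x ++ x) [::].
Proof.
elim: x => [|i x IH]; first exact: rst_refl.
apply: rst_trans IH; rewrite rev_cons cat_rcons.
by apply: rst_step; apply: (InContext (rev x) x (CoxSquare i)).
Qed.

(* W(A_n), given by its presentation *)
Definition cox n : Type := {eq_quot (cox_equiv n)}%qT.

HB.instance Definition _ n := Choice.on (cox n).
HB.instance Definition _ n := EqQuotient.on (cox n).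

Section Group.
Local Open Scope quotient_scope.
Context (n : nat).

Definition cox_mul (a b : cox n) : cox n := \pi_(cox n) (repr a ++ repr b).
Definition cox_one : cox n := \pi_(cox n) [::].
Definition cox_inv (a : cox n) : cox n := \pi_(cox n) (rev (repr a)).

Lemma cox_ind (P : cox n -> Prop) :
  (forall x, P (\pi_(cox n) x)) -> forall a, P a.
Proof. by move=> Px a; rewrite -(reprK a). Qed.

Lemma cox_piP (x y : seq 'I_n) : cox_eq x y <-> \pi_(cox n) x = \pi_(cox n) y.
Proof. by split=> [xy|/eqmodP/asboolP//]; apply/eqmodP/asboolP. Qed.

Lemma cox_reprK (x : seq 'I_n) : cox_eq (repr (\pi_(cox n) x)) x.
Proof. by apply/cox_piP; rewrite reprK. Qed.

Lemma cox_mulE (x y : seq 'I_n) :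
  cox_mul (\pi_(cox n) x) (\pi_(cox n) y) = \pi_(cox n) (x ++ y).
Proof. by apply/cox_piP/cox_eq_cat; apply: cox_reprK. Qed.

Lemma cox_invE (x : seq 'I_n) : cox_inv (\pi_(cox n) x) = \pi_(cox n) (rev x).
Proof. by apply/cox_piP/cox_eq_rev/cox_reprK. Qed.

Lemma cox_mulA : associative cox_mul.
Proof.
by elim/cox_ind=> x; elim/cox_ind=> y; elim/cox_ind=> z; rewrite !cox_mulE catA.
Qed.

Lemma cox_mul1 : left_id cox_one cox_mul.
Proof. by elim/cox_ind=> x; rewrite cox_mulE. Qed.

Lemma cox_mulr1 : right_id cox_one cox_mul.
Proof. by elim/cox_ind=> x; rewrite cox_mulE cats0. Qed.

Lemma cox_mulV : left_inverse cox_one cox_inv cox_mul.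
Proof.
elim/cox_ind=> x; rewrite cox_invE cox_mulE.
exact/cox_piP/cox_eq_rev_cat.
Qed.

Lemma cox_mulrV : right_inverse cox_one cox_inv cox_mul.
Proof.
elim/cox_ind=> x; rewrite cox_invE cox_mulE.
by apply/cox_piP; rewrite -{1}(revK x); apply: cox_eq_rev_cat.
Qed.
End Group.

HB.instance Definition _ n := isGroup.Build (cox n)
  (@cox_mulA n) (@cox_mul1 n) (@cox_mulr1 n) (@cox_mulV n) (@cox_mulrV n).

Local Open Scope group_scope.

Definition gen n (i : 'I_n) : cox n := (\pi_(cox n) [:: i])%qT.

Definition word_prod n (x : seq 'I_n) : cox n := \prod_(i <- x) gen i.

Definition conjugate n (w y : cox n) : Prop := exists g : cox n, y = w ^ g.

Definition reduced_expr n (w : cox n) (x : seq 'I_n) : Prop :=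
  word_prod x = w /\ forall y, word_prod y = w -> size x <= size y.

Inductive commutation n : seq 'I_n -> seq 'I_n -> Prop :=
  Commutation i j : far i j -> commutation [:: i; j] [:: j; i].

Definition comm_equiv n : seq 'I_n -> seq 'I_n -> Prop :=
  clos_refl_trans _ (in_context (@commutation n)).

Definition FC n (w : cox n) : Prop :=
  forall x y, reduced_expr w x -> reduced_expr w y -> comm_equiv x y.

Definition CFC n (w : cox n) : Prop :=
  forall x, reduced_expr w x ->
  forall k, exists v, reduced_expr v (rot k x) /\ FC v.

(* Finite labeled posets, with blocks numbered from 0 to size - 1 *)
Record lposet n := LPoset {
  nblocks : nat;
  hle : rel 'I_nblocks;
  hlabel : 'I_nblocks -> 'I_n;
  hle_refl : reflexive hle;
  hle_anti : antisymmetric hle;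
  hle_trans : transitive hle }.

Definition block n (H : lposet n) : finType := 'I_(nblocks H).
Coercion block : lposet >-> finType.

Definition lposet_iso n (H K : lposet n) : Prop :=
  exists f : H -> K,
    [/\ bijective f, forall a, hlabel (f a) = hlabel a
      & forall a b, hle (f a) (f b) = hle a b].

(* Letters further left are higher, so j lies below i when i < j.  The order
   [hle] is the reflexive version of the transitive closure. *)
Definition heap_step n (x : seq 'I_n) : rel 'I_(size x) :=
  fun j i => (i < j) &&
    (gen (tnth (in_tuple x) i) * gen (tnth (in_tuple x) j)
       != gen (tnth (in_tuple x) j) * gen (tnth (in_tuple x) i)).

Lemma heap_order_anti n (x : seq 'I_n) : antisymmetric (connect (@heap_step n x)).
Proof.
have le_conn j i : connect (@heap_step n x) j i -> i <= j.
  case/connectP=> p; elim: p j => [|k p IH] j /= => [_ -> //|].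
  case/andP=> /andP[kj _] /IH{}IH /IH ik; exact: leq_trans ik (ltnW kj).
move=> j i /andP[/le_conn ij /le_conn ji].
by apply/val_inj/anti_leq; rewrite ij ji.
Qed.

Definition heap n (x : seq 'I_n) : lposet n :=
  @LPoset n (size x) (connect (@heap_step n x)) (tnth (in_tuple x))
    (@connect0 _ _) (@heap_order_anti n x) (@connect_trans _ _).

(* Heaps are taken up to isomorphism, so H(w) is the class of all labeled
   posets isomorphic to the heap of a reduced expression for w. *)
Definition heap_of n (w : cox n) : set (lposet n) :=
  fun H => exists x, reduced_expr w x /\ lposet_iso H (heap x).

Definition cyclic_shift n (H H' : lposet n) : Prop :=
  exists (w : cox n) (i : 'I_n) (u : seq 'I_n),
    [/\ CFC w, reduced_expr w (i :: u), lposet_iso H (heap (i :: u))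
      & lposet_iso H' (heap (rcons u i))].

(* Isomorphic heaps are identified. *)
Definition cyc_equiv n : lposet n -> lposet n -> Prop :=
  clos_refl_sym_trans _ (fun H H' => lposet_iso H H' \/ cyclic_shift H H').

Definition cyl_heap n (w : cox n) : set (lposet n) :=
  fun H => exists2 H0, heap_of w H0 & cyc_equiv H0 H.

Definition covers n (H : lposet n) : rel H :=
  fun a b => [&& a != b, hle a b
    & [forall c, (hle a c && hle c b) ==> (c == a) || (c == b)]].

Definition component n (H : lposet n) (a : H) : {set H} :=
  [set b | connect (fun c d => covers c d || covers d c) a b]%SET.

Definition convex n (H : lposet n) (A : {set H}) : Prop :=
  forall a b c, a \in A -> c \in A -> hle a b -> hle b c -> b \in A.

Lemma sub_anti n (H : lposet n) (A : {set H}) :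
  antisymmetric (fun a b : 'I_#|A| => hle (enum_val a) (enum_val b)).
Proof. by move=> a b /hle_anti/enum_val_inj. Qed.

Definition subheap n (H : lposet n) (A : {set H}) : lposet n :=
  @LPoset n #|A| (fun a b => hle (enum_val a) (enum_val b))
    (fun a => hlabel (enum_val a)) (fun a => hle_refl (enum_val a))
    (@sub_anti n H A)
    (fun b a c => @hle_trans n H (enum_val b) (enum_val a) (enum_val c)).

Definition chunk n (H C : lposet n) : Prop :=
  exists A : {set H},
    [/\ convex A, exists a, A = component a & lposet_iso C (subheap A)].

(* A chunk of the heap of a CFC element is itself the heap of a CFC element,
   so [cyc_equiv] also expresses chunk equivalence. *)
Definition ring_of n (C : lposet n) : set (lposet n) := fun D => cyc_equiv C D.

(* Distinct chunks of the heap of a CFC element have different labels, hence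
   distinct rings; and a cyclic shift of a heap shifts one of its chunks, so
   the rings do not depend on the representative of the cylindrical heap. *)
Definition rings n (K : set (lposet n)) : set (set (lposet n)) :=
  fun R => exists H C, [/\ K H, chunk H C & R = ring_of C].

Definition same_size n (R R' : set (lposet n)) : Prop :=
  forall C D, R C -> R' D -> nblocks C = nblocks D.

Definition ring_equivalent n (K K' : set (lposet n)) : Prop :=
  exists f : set (lposet n) -> set (lposet n),
    set_bij (rings K) (rings K') f /\ forall R, rings K R -> same_size R (f R).

(* Main.v *)
(* A reduced word of a CFC element repeats no letter: between two consecutive
   (cyclic) occurrences of the largest repeated letter there is a factor
   violating full commutativity.  Conversely words without repetition are
   reduced and CFC, as seen from the action on {0, ..., n} and its initial
   segments.  Since the support is a forest, all words without repetition on a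
   given support are related by commutations and cyclic shifts; hence a ring is
   determined by its set of labels, the rings of H^(w) are the maximal runs of
   consecutive generators in the support of w, and w is conjugate to the
   increasing product of its support, in which a run of m generators acts as an
   (m+1)-cycle.  It remains to identify W(A_n) with the symmetric group, where
   conjugacy is equality of cycle types. *)

From Stdlib Require Import Relation_Operators.
From mathcomp Require Import all_boot all_fingroup zify.
From mathcomp Require Import boolp.
Require Import Defs.

Set Implicit Arguments.
Unset Strict Implicit.
Unset Printing Implicit Defensive.

Local Open Scope group_scope.

Lemma split_first (T : eqType) (a : T) s :
  a \in s -> exists s1 s2, s = s1 ++ a :: s2 /\ a \notin s1.
Proof.
elim: s => // b s IH; have [->|ab] := eqVneq a b; first by exists [::], s.
rewrite inE (negPf ab) => /IH[s1 [s2 [-> as1]]].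
by exists (b :: s1), s2; rewrite inE (negPf ab).
Qed.

(** * Products of words in the Coxeter group and as permutations *)

Section Words.
Variable n : nat.
Implicit Types (i j : 'I_n) (x y z u v : seq 'I_n) (p q : 'I_n.+1).
Implicit Types (w : cox n) (s t : {perm 'I_n.+1}).

Lemma word_prod_pi x : word_prod x = (\pi_(cox n) x)%qT.
Proof.
elim: x => [|i x IH]; first by rewrite /word_prod big_nil.
rewrite /word_prod big_cons -/(word_prod x) IH; exact: (@cox_mulE n [:: i] x).
Qed.

Lemma word_prod_eqP x y : word_prod x = word_prod y <-> cox_eq x y.
Proof. by rewrite !word_prod_pi; split=> /cox_piP. Qed.

Lemma word_prod_onto w : exists x, w = word_prod x.
Proof. by exists (generic_quotient.repr w); rewrite word_prod_pi reprK. Qed.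

Lemma word_prod_cat x y : word_prod (x ++ y) = word_prod x * word_prod y.
Proof. by rewrite /word_prod big_cat. Qed.

Lemma word_prod_cons i x : word_prod (i :: x) = gen i * word_prod x.
Proof. by rewrite /word_prod big_cons. Qed.

Lemma word_prod_nil : word_prod [::] = 1 :> cox n.
Proof. by rewrite /word_prod big_nil. Qed.

Lemma word_prod1 i : word_prod [:: i] = gen i.
Proof. by rewrite word_prod_cons word_prod_nil mulg1. Qed.

Lemma word_prod_relation x y : cox_relation x y -> word_prod x = word_prod y.
Proof.
move=> r; apply/word_prod_eqP/rst_step; have := InContext [::] [::] r.
by rewrite !cats0.
Qed.

Lemma gen_sq i : gen i * gen i = 1.
Proof.
by have := word_prod_relation (CoxSquare i); rewrite !word_prod_cons word_prod_nil mulg1.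
Qed.

Lemma gen_far i j : far i j -> gen i * gen j = gen j * gen i.
Proof.
by move=> /CoxComm/word_prod_relation; rewrite !word_prod_cons word_prod_nil !mulg1.
Qed.

Lemma gen_braid i j : near i j -> gen i * (gen j * gen i) = gen j * (gen i * gen j).
Proof.
by move=> /CoxBraid/word_prod_relation; rewrite !word_prod_cons word_prod_nil !mulg1.
Qed.

Lemma genV i : (gen i)^-1 = gen i.
Proof. by apply: (mulgI (gen i)); rewrite mulgV gen_sq. Qed.

(** The transposition of the points i and i + 1 of {0, ..., n}: [widen_ord] yields i and
    [lift ord0 i] yields i + 1. *)
Definition simple_perm i : {perm 'I_n.+1} :=
  tperm (widen_ord (leqnSn n) i) (lift ord0 i).

Lemma simple_permE i p :
  simple_perm i p = (if p == i :> nat then i.+1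
                     else if p == i.+1 :> nat then i : nat else p) :> nat.
Proof.
rewrite /simple_perm; case: tpermP => [->|->|pi pSi] /=; first by rewrite eqxx.
  by rewrite /bump /= add1n eqxx gtn_eqF.
case: eqP => [e|_]; first by case: pi; apply: val_inj.
by case: eqP => // e; case: pSi; apply: val_inj; rewrite /= /bump /= add1n.
Qed.

Local Ltac case_simple_perm :=
  rewrite ?permM !simple_permE;
  repeat match goal with |- context [if @eq_op _ ?a ?b then _ else _] =>
    lazymatch a with
    | context [if _ then _ else _] => fail
    | _ => case: (@eqP _ a b) => ? /=
    end
  end.

(** Products of permutations apply the left factor first, so the first letter of the word acts
    first. *)
Definition word_perm x : {perm 'I_n.+1} := \prod_(i <- x) simple_perm i.

Lemma word_perm_cat x y : word_perm (x ++ y) = word_perm x * word_perm y.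
Proof. by rewrite /word_perm big_cat. Qed.

Lemma word_perm_cons i x : word_perm (i :: x) = simple_perm i * word_perm x.
Proof. by rewrite /word_perm big_cons. Qed.

Lemma word_perm_nil : word_perm [::] = 1.
Proof. by rewrite /word_perm big_nil. Qed.

Lemma word_perm_relation x y : cox_relation x y -> word_perm x = word_perm y.
Proof.
case=> [i|i j ij|i j ij]; rewrite !word_perm_cons !word_perm_nil ?mulg1.
- exact: tperm2.
- apply/permP => p; apply: val_inj; move: ij; rewrite /= /far.
  by case_simple_perm; lia.
- apply/permP => p; apply: val_inj; move: ij; rewrite /= /near.
  by case_simple_perm; lia.
Qed.

Lemma cox_eq_word_perm x y : cox_eq x y -> word_perm x = word_perm y.
Proof.
elim=> {x y} [_ _ [u v x y r]|//|//|x z y _ -> //].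
by rewrite !word_perm_cat (word_perm_relation r).
Qed.

Lemma word_prod_perm x y : word_prod x = word_prod y -> word_perm x = word_perm y.
Proof. by move/word_prod_eqP/cox_eq_word_perm. Qed.

(** * Supports of words, detected by initial segments *)

Definition stabilises_initial (k : nat) s := forall p, (s p <= k) = (p <= k).

Lemma stabilises_mul k s t :
  stabilises_initial k s -> stabilises_initial k t -> stabilises_initial k (s * t).
Proof. by move=> hs ht p; rewrite permM ht hs. Qed.

Lemma stabilises_inv k s : stabilises_initial k s -> stabilises_initial k s^-1.
Proof. by move=> hs p; rewrite -hs permKV. Qed.

Lemma stabilises_word x i : i \notin x -> stabilises_initial i (word_perm x).
Proof.
elim: x => [_|j x IH]; first by move=> p; rewrite word_perm_nil perm1.
rewrite inE negb_or word_perm_cons => /andP[ij /IH]; apply: stabilises_mul => p.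
have {ij}: i != j :> nat by [].
by case_simple_perm; lia.
Qed.

Lemma word_perm_fix x p : all (fun i : 'I_n => i.+1 < p) x -> word_perm x p = p.
Proof.
elim: x => [_|i x IH /= /andP[ip /IH e]]; first by rewrite word_perm_nil perm1.
rewrite word_perm_cons permM (_ : simple_perm i p = p) //.
by apply: ord_inj; case_simple_perm; lia.
Qed.

(** If [i] occurred, its single occurrence could be isolated: [simple_perm i] would be a product of
    permutations preserving {0, ..., i}, yet it sends i to i + 1. *)
Lemma uniq_stabilises x i :
  uniq x -> stabilises_initial i (word_perm x) -> i \notin x.
Proof.
move=> ux hs; apply/negP => ix; case/splitPr: ix ux hs => a b.
rewrite cat_uniq /= negb_or => /and3P[_ /andP[ia _] /andP[ib _]].
rewrite word_perm_cat word_perm_cons => hs.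
have ha := stabilises_word ia; have hb := stabilises_word ib.
have := stabilises_mul (stabilises_mul (stabilises_inv ha) hs) (stabilises_inv hb).
rewrite mulKg mulgK => /(_ (widen_ord (leqnSn n) i)).
by rewrite simple_permE /= eqxx leqnn ltnn.
Qed.

Lemma uniq_support x y :
  uniq x -> word_perm x = word_perm y -> {subset x <= y}.
Proof.
move=> ux xy i ix; apply: contraLR ix => iy.
by apply: uniq_stabilises => //; rewrite xy; apply: stabilises_word.
Qed.

(** Every expression of the same element must use each letter of [x], hence is at least as long. *)
Lemma uniq_reduced x : uniq x -> reduced_expr (word_prod x) x.
Proof.
move=> ux; split=> // y /esym/word_prod_perm xy.
exact: uniq_leq_size (uniq_support ux xy).
Qed.

Lemma reduced_uniq x y :
  uniq x -> reduced_expr (word_prod x) y -> uniq y /\ perm_eq x y.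
Proof.
move=> ux [yx ymin]; have sxy := uniq_support ux (word_prod_perm (esym yx)).
have hs := ymin x erefl; have uy := leq_size_uniq ux sxy hs.
split=> //; apply: uniq_perm => //; exact: (uniq_min_size ux sxy hs).2.
Qed.

(** * Commutation equivalence and full commutativity *)

Lemma comm_equiv_context u v x y :
  comm_equiv x y -> comm_equiv (u ++ x ++ v) (u ++ y ++ v).
Proof.
elim=> {x y} [_ _ [a b x y r]|x|x z y _ xz _ zy]; last exact: rt_trans xz zy.
  rewrite -!catA !(catA u); apply: rt_step; exact: InContext.
exact: rt_refl.
Qed.

Lemma farC i j : far i j = far j i.
Proof. by rewrite /far orbC. Qed.

Lemma nearC i j : near i j = near j i.
Proof. by rewrite /near orbC. Qed.

Lemma farP i j : i != j -> far i j = ~~ near i j.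
Proof.
by move=> ij; have {ij}: i != j :> nat by []; rewrite /far /near; lia.
Qed.

Lemma comm_equiv_pass i a :
  all (far i) a -> comm_equiv (rcons a i) (i :: a).
Proof.
elim: a => [_|j a IH /=]; first exact: rt_refl.
case/andP=> ij /IH/(comm_equiv_context [:: j] [::]); rewrite /= !cats0 => h.
apply: rt_trans h _; apply: rt_step.
by apply: (@InContext _ _ [::] a [:: j; i] [:: i; j]); constructor; rewrite farC.
Qed.

Lemma comm_equiv_perm x y : comm_equiv x y -> perm_eq x y.
Proof.
elim=> {x y} [_ _ [a b _ _ [i j _]]|x|x z y _ xz _ zy] //; last exact: perm_trans zy.
by rewrite perm_cat2l perm_cat2r (perm_catC [:: i] [:: j]).
Qed.

Lemma comm_equiv_prod x y : comm_equiv x y -> word_prod x = word_prod y.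
Proof.
elim=> {x y} [_ _ [a b _ _ [i j ij]]|//|x z y _ -> _ -> //].
rewrite !word_prod_cat; congr (_ * (_ * _)).
by rewrite !word_prod_cons word_prod_nil !mulg1 gen_far.
Qed.

(* If [i] can be moved to the front, the prefix [a] fixes both [i] and
   [i + 1], so it cannot contain a neighbour of [i]. *)
Lemma uniq_prefix_far i u a b :
  uniq (i :: u) -> uniq (a ++ i :: b) -> word_perm (i :: u) = word_perm (a ++ i :: b) ->
  all (far i) a.
Proof.
rewrite cat_uniq /= negb_or => /andP[iu _] /and3P[ua /andP[ia _] /andP[ib _]].
rewrite word_perm_cons word_perm_cat word_perm_cons => e.
have ha := stabilises_word ia.
(* Solving [e] for the conjugated prefix gives the permutation of [u] times the inverse of that of
   [b], and neither word contains [i]. *)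
have hc : stabilises_initial i (simple_perm i * word_perm a * simple_perm i).
  have -> : simple_perm i * word_perm a * simple_perm i = word_perm u * (word_perm b)^-1.
    apply: (mulIg (word_perm b)); rewrite mulgKV -!mulgA -e.
    by rewrite mulgA tperm2 mul1g.
  exact: stabilises_mul (stabilises_word iu) (stabilises_inv (stabilises_word ib)).
set A := word_perm a in ha hc.
pose p := widen_ord (leqnSn n) i; pose q := lift ord0 i : 'I_n.+1.
have sp : simple_perm i p = q by rewrite /simple_perm tpermL.
have sq : simple_perm i q = p by rewrite /simple_perm tpermR.
have qE : q = i.+1 :> nat by [].
(* [A] preserves {0, ..., i} and, by [hc], also its image {0, ..., i - 1, i + 1} under
   [simple_perm i]; the two set differences are the singletons of i and i + 1. *)
have Ap : A p = p.
  apply: val_inj; move: (hc q) (ha p); rewrite !permM sq simple_permE qE /=.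
  by do ![case: eqP => ? /=]; lia.
have Aq : A q = q.
  apply: val_inj; move: (hc p) (ha q); rewrite !permM sp simple_permE qE /= /bump add1n.
  by do ![case: eqP => ? /=]; lia.
have ne r r' : r != r' -> A r != A r' :> nat.
  by apply: contraNN => /eqP/val_inj/perm_inj->.
apply/allP => j ja; have ij : i != j by apply: contraNneq ia => ->.
(* Preserving {0, ..., i} and fixing i and i + 1, [A] also preserves {0, ..., i + 1} and {0, ..., i
   - 1}, which excludes the letters i + 1 and i - 1 from [a]. *)
rewrite farP //; apply/negP => /orP[] /eqP hj; move/negP: (ja); apply.
  apply/negP/uniq_stabilises => // r; rewrite -/A -hj -qE.
  have [->|/ne] := eqVneq r q; first by rewrite Aq.
  rewrite Aq => h1; move: (ha r) h1; case: (eqVneq r q) => [->|]; first by rewrite Aq eqxx.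
  by rewrite -val_eqE /= /bump /=; lia.
apply/negP/uniq_stabilises => // r; rewrite -/A.
have [->|] := eqVneq r p; first by rewrite Ap.
move=> rp; have := ne _ _ rp; move: (ha r) rp; rewrite Ap -val_eqE /=; lia.
Qed.

(** The first letter of [x] occurs in [y] behind letters that all commute with it, so it moves to
    the front of [y] and cancels; the rest is induction. *)
Lemma uniq_comm_equiv x y :
  uniq x -> uniq y -> x =i y -> word_perm x = word_perm y -> comm_equiv x y.
Proof.
elim: x y => [|i u IH] y ux uy xy exy.
  have -> : y = [::] by apply/nilP; rewrite /nilp -(uniq_size_uniq ux xy).
  exact: rt_refl.
have iy : i \in y by rewrite -xy mem_head.
case/splitPr: iy uy xy exy => a b uy xy exy.
have far_a := uniq_prefix_far ux uy exy.
have pe : comm_equiv (rcons a i ++ b) (i :: a ++ b).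
  exact: (comm_equiv_context [::] b (comm_equiv_pass far_a)).
(* [comm_equiv] is not symmetric by construction, so the reverse chain is built separately. *)
have pe' : comm_equiv (i :: a ++ b) (rcons a i ++ b).
  elim: {+}a far_a {pe xy exy uy} => [_|j a' IHa /= /andP[ij /IHa h]]; first exact: rt_refl.
  apply: (@rt_trans _ _ _ (j :: i :: a' ++ b)).
    by apply: rt_step; apply: (@InContext _ _ [::] (a' ++ b) [:: i; j] [:: j; i]); constructor.
  by have := comm_equiv_context [:: j] [::] h; rewrite !cats0.
have pab : perm_eq (i :: a ++ b) (a ++ i :: b).
  by rewrite -cat_rcons perm_sym; apply: comm_equiv_perm pe.
rewrite -cat_rcons; apply: rt_trans pe'.
have /= /andP[iab uab] : uniq (i :: a ++ b) by rewrite (perm_uniq pab).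
case/andP: ux => iu uu.
have := comm_equiv_context [:: i] [::] (IH (a ++ b) uu uab _ _).
rewrite !cats0; apply.
  move=> j; have := xy j; rewrite -(perm_mem pab) !inE.
  by case: eqP => [->|//]; rewrite (negPf iu) (negPf iab).
apply: (mulgI (simple_perm i)); rewrite -!word_perm_cons exy -cat_rcons.
by apply: word_prod_perm; apply: comm_equiv_prod.
Qed.

Lemma uniq_FC x : uniq x -> FC (word_prod x).
Proof.
move=> ux y z ry rz; have [uy xy] := reduced_uniq ux ry.
have [uz xz] := reduced_uniq ux rz.
apply: uniq_comm_equiv => // [i|]; first by rewrite -(perm_mem xy) (perm_mem xz).
by apply: word_prod_perm; rewrite ry.1 rz.1.
Qed.

Lemma uniq_CFC x : uniq x -> CFC (word_prod x).
Proof.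
move=> ux y ry k; have [uy _] := reduced_uniq ux ry.
exists (word_prod (rot k y)); split; [apply: uniq_reduced|apply: uniq_FC]; by rewrite rot_uniq.
Qed.

(** * CFC elements have no repeated letters *)

Lemma gen_far_word i a :
  all (far i) a -> gen i * word_prod a = word_prod a * gen i.
Proof.
move/comm_equiv_pass/comm_equiv_prod.
by rewrite -cats1 word_prod_cat word_prod1 word_prod_cons.
Qed.

(* Between two consecutive occurrences of [i] there are at least two
   neighbours of [i]; if none of them is [i + 1], two of them are equal to
   [i - 1], and one descends. *)
Lemma FC_no_repeat w i u a v :
  FC w -> reduced_expr w (u ++ i :: a ++ i :: v) -> i \notin a ->
  (forall j, j \in a -> i.+1 != j) -> False.
Proof.
move=> fcw; have [m] := ubnP (i : nat); elim: m i u a v => // m IH i u a v lei rw ia nia.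
have far_i b : {subset b <= a} -> (forall j, j \in b -> j.+1 != i) -> all (far i) b.
  move=> sb nb; apply/allP => j jb.
  have ij : i != j by apply: contraNneq ia => ->; apply: sb.
  by rewrite farP // /near (negPf (nia _ (sb _ jb))) (negPf (nb _ jb)).
have [/hasP[j ja /eqP ji]|/hasPn no] := boolP (has (fun j : 'I_n => j.+1 == i) a); last first.
  (* Without a neighbour of [i] in between, the two letters [i] meet and cancel, which gives a
     shorter expression. *)
  have /gen_far_word ca := far_i _ (fun=> id) no.
  case: rw => ew /(_ (u ++ a ++ v)); rewrite -ew.
  rewrite !(word_prod_cat, word_prod_cons) (mulgA (gen i) (word_prod a)) ca.
  rewrite -(mulgA _ (gen i)) (mulgA (gen i) (gen i)) gen_sq mul1g.
  by move=> /(_ erefl); rewrite !size_cat /= !size_cat /=; lia.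
have [a1 [a2 [ea ja1]]] := split_first ja.
have nia1 k : k \in a1 -> k.+1 != i.
  by move=> ka1; apply: contraNneq ja1 => ki; rewrite (_ : j = k) //; apply: ord_inj; lia.
have a1a : {subset a1 <= a} by move=> k ka1; rewrite ea mem_cat ka1.
have [ja2|ja2] := boolP (j \in a2).
  have [a3 [a4 [ea2 ja3]]] := split_first ja2.
  apply: (IH j (u ++ i :: a1) a3 (a4 ++ i :: v)); first by lia.
  - by move: rw; rewrite ea ea2; do 3!rewrite -?catA /=.
  - exact: ja3.
  move=> k ka3; rewrite ji; apply: contraNneq ia => ik.
  by rewrite (_ : i = k) ?ea ?ea2; [rewrite !(mem_cat, inE) ka3 !orbT|apply: val_inj].
have a2a : {subset a2 <= a} by move=> k ka2; rewrite ea mem_cat inE ka2 !orbT.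
have nia2 k : k \in a2 -> k.+1 != i.
  by move=> ka2; apply: contraNneq ja2 => ki; rewrite (_ : j = k) //; apply: ord_inj; lia.
(* Now [j] is the only neighbour of [i] in [a], so both outer letters [i] slide next to it and a
   braid relation applies. *)
have c1 := gen_far_word (far_i _ a1a nia1); have c2 := gen_far_word (far_i _ a2a nia2).
have nij : near i j by rewrite /near ji eqxx orbT.
have eb : word_prod (u ++ a1 ++ [:: j; i; j] ++ a2 ++ v) = word_prod (u ++ i :: a ++ i :: v).
  rewrite ea !(word_prod_cat, word_prod_cons, word_prod_nil) ?mulg1 -!mulgA.
  rewrite (mulgA _ (gen i) (word_prod v)) -c2 (mulgA (gen i) (word_prod a1)) c1 -!mulgA.
  have /(congr1 (mulg^~ (word_prod a2 * word_prod v))) := gen_braid nij.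
  by rewrite -!mulgA => ->.
have rb : reduced_expr w (u ++ a1 ++ [:: j; i; j] ++ a2 ++ v).
  case: rw => ew wmin; split; first by rewrite eb.
  move=> z /wmin; apply: leq_trans.
  by rewrite ea; do 3!rewrite ?size_cat /=; lia.
(* Commutations preserve the number of letters [i], whereas the braid relation lowered it by one. *)
have /comm_equiv_perm/seq.permP/(_ (pred1 i)) := fcw _ _ rw rb.
rewrite ea; do 3!rewrite ?count_cat /=; rewrite eqxx.
have -> : (j == i) = false by apply/eqP => /(congr1 val) /=; lia.
lia.
Qed.

(** If [i] is the largest repeated letter, i + 1 occurs at most once, so one of two successive
    cyclic gaps between letters [i] avoids it. A rotation brings that gap to the front, where
    [FC_no_repeat] applies. *)
Lemma CFC_uniq w x : CFC w -> reduced_expr w x -> uniq x.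
Proof.
move=> cw rx; apply/negPn/negP => nux.
have no_rep k i a v : rot k x = i :: a ++ i :: v -> i \notin a ->
    (forall j, j \in a -> i.+1 != j) -> False.
  move=> e; have [w' [rw' fw']] := cw _ rx k; rewrite e in rw'.
  exact: (FC_no_repeat (u := [::]) fw' rw').
have [i0 i0x] : exists i, 1 < count_mem i x.
  apply/existsP; apply: contraNT nux => /existsPn h.
  apply: count_mem_uniq => i; have := h i; rewrite -has_pred1 has_count.
  by case: (count_mem i x) => [|[]].
have [i ix imax] : exists2 i, 1 < count_mem i x & forall j, 1 < count_mem j x -> j <= i.
  case: (@arg_maxnP _ i0 (fun i => 1 < count_mem i x) (fun i => i : nat) i0x) => i ix imax.
  by exists i.
have ixm : i \in x by rewrite -has_pred1 has_count; apply: leq_trans ix.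
have [k y ey] := rot_to ixm.
have cy j : count_mem j (i :: y) = count_mem j x.
  by rewrite -ey; apply/seq.permP/permPl/perm_rot.
have iy : i \in y by rewrite -has_pred1 has_count; move: ix; rewrite -cy /= eqxx.
have [a [b [eab ia]]] := split_first iy; rewrite {}eab in ey cy.
have [/hasP[j ja /eqP ij]|/hasPn nia] := boolP (has (fun j : 'I_n => i.+1 == j) a); last first.
  exact: no_rep ey ia nia.
(* By maximality of [i], the letter [j], which is i + 1, is not repeated, and its occurrence lies in
   [a]. *)
have jb : j \notin b.
  have ji : (i == j) = false by apply/eqP => /(congr1 (@nat_of_ord n)); lia.
  apply/negP => jb; suff : j <= i by rewrite -ij ltnn.
  apply: (imax j); rewrite -cy /= count_cat /= ji.
  by rewrite !add0n (@leq_add 1 1) // -has_count has_pred1.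
have nib l : l \in b -> i.+1 != l.
  by apply: contraTneq => il; rewrite (_ : l = j) //; apply: ord_inj; rewrite -ij.
have ebr : rot (rot_add x k (size a).+1) x = i :: b ++ i :: a.
  by rewrite -rot_rot_add ey -cat_cons (rot_size_cat (i :: a)).
have [ib|ib] := boolP (i \in b); last exact: no_rep ebr ib nib.
have [b1 [b2 [eb ib1]]] := split_first ib; rewrite eb -catA in ebr nib.
by apply: no_rep ebr ib1 _ => l lb1; apply: nib; rewrite mem_cat lb1.
Qed.

Lemma CFC_word w : CFC w -> exists2 x, uniq x & w = word_prod x.
Proof.
move=> cw; have [x0 ex0] := word_prod_onto w.
pose P m := `[< exists2 x, word_prod x = w & size x = m >].
have exP : exists m, P m by exists (size x0); apply/asboolP; exists x0.
case: (ex_minnP exP) => m /asboolP[x ex sx] xmin; exists x => //.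
apply: CFC_uniq cw _; split=> // y ey; rewrite sx.
by apply: xmin; apply/asboolP; exists y.
Qed.

(** * Cyclic words *)

Definition word_shift x y := exists i u, x = i :: u /\ y = rcons u i.

Definition cyclic_comm x y := in_context (@commutation n) x y \/ word_shift x y.

Definition cyclic_comm_equiv := clos_refl_sym_trans _ cyclic_comm.

Lemma comm_cyclic_equiv x y : comm_equiv x y -> cyclic_comm_equiv x y.
Proof.
elim=> {x y} [x y r|x|x z y _ xz _ zy].
- by apply: rst_step; left.
- exact: rst_refl.
- exact: rst_trans xz zy.
Qed.

Lemma cyclic_equiv_rot k x : cyclic_comm_equiv x (rot k x).
Proof.
elim: k => [|k IH]; first by rewrite rot0; exact: rst_refl.
apply: rst_trans IH _; have [kx|kx] := ltnP k (size x); last first.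
  by rewrite !rot_oversize ?(leqW kx) //; exact: rst_refl.
apply: rst_step; right; rewrite rotS //.
case e: (rot k x) => [|i u]; last by exists i, u; rewrite rot1_cons.
by move: kx; rewrite -(size_rot k) e.
Qed.

Lemma cyclic_equiv_perm x y : cyclic_comm_equiv x y -> perm_eq x y.
Proof.
elim=> {x y} [x y [xy|[i [u [-> ->]]]]|//|x y _|x z y _ xz _]; last exact: perm_trans.
- exact: comm_equiv_perm (rt_step _ _ _ _ xy).
- by rewrite perm_sym perm_rcons.
by rewrite perm_sym.
Qed.

(* A rotation of [i :: u] lifts to [m :: i :: u]: the only difficult case is
   [i + 1 = m], where [m] first travels around [u], which it commutes with. *)
Lemma cyclic_equiv_cons m x y :
  cyclic_comm_equiv x y -> uniq (m :: x) -> all (fun j : 'I_n => j < m) x ->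
  cyclic_comm_equiv (m :: x) (m :: y).
Proof.
elim=> {x y} [x y|x _ _|x y xy IH uy my|x z y xz IH1 zy IH2 ux mx].
- case=> [xy _ _|[i [u [-> ->]]] umx mx].
    apply: comm_cyclic_equiv; have := comm_equiv_context [:: m] [::] (rt_step _ _ _ _ xy).
    by rewrite !cats0.
  have [imf|imn] := boolP (far i m).
    apply: (@rst_trans _ _ _ (i :: m :: u)).
      apply/comm_cyclic_equiv/rt_step; apply: (@InContext _ _ [::] u [:: m; i] [:: i; m]).
      by constructor; rewrite farC.
    by apply: rst_step; right; exists i, (m :: u).
  have far_u : all (far m) u.
    case/and3P: umx => _ iu _; case/andP: mx => im /allP mu.
    apply/allP => j ju; have ji : j != i :> nat by apply: contraNneq iu => /val_inj <-.
    by move: imn ji im (mu _ ju); rewrite /far; lia.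
  apply: (@rst_trans _ _ _ (i :: rcons u m)).
    by apply: rst_step; right; exists m, (i :: u).
  apply: (@rst_trans _ _ _ (i :: m :: u)).
    apply: comm_cyclic_equiv; have := comm_equiv_context [:: i] [::] (comm_equiv_pass far_u).
    by rewrite !cats0.
  by apply: rst_step; right; exists i, (m :: u).
- exact: rst_refl.
- have p := cyclic_equiv_perm xy; apply/rst_sym/IH.
    by rewrite (perm_uniq (_ : perm_eq _ (m :: y))) ?perm_cons.
  by rewrite (perm_all _ p).
- have p := cyclic_equiv_perm xz; apply: rst_trans (IH1 ux mx) (IH2 _ _).
    by rewrite -(perm_uniq (_ : perm_eq (m :: x) _)) ?perm_cons.
  by rewrite -(perm_all _ p).
Qed.

(* The support of a word is a forest, so any two acyclic orientations of its
   Coxeter graph are related by source-to-sink moves. *)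
Lemma uniq_cyclic_equiv x y :
  uniq x -> perm_eq x y -> cyclic_comm_equiv x y.
Proof.
have [m] := ubnP (size x); elim: m x y => // m IH x y szx ux xy.
case: (posnP (size x)) => [/size0nil x0|x_gt0].
  by move: xy; rewrite x0 perm_sym => /perm_nilP ->; exact: rst_refl.
have [i0 i0x] : exists i, i \in x by case: (x) x_gt0 => // i ? _; exists i; apply: mem_head.
(* The largest letter has at most one neighbour in the support. It is rotated to the front of both
   words and removed; [cyclic_equiv_cons] restores it. *)
have [i ix imax] : exists2 i, i \in x & forall j, j \in x -> j <= i.
  case: (@arg_maxnP _ i0 (mem x) (fun i => i : nat) i0x) => i ix imax.
  by exists i.
have iy : i \in y by rewrite -(perm_mem xy).
have [k u eu] := rot_to ix; have [l v ev] := rot_to iy.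
have pu : perm_eq (i :: u) x by rewrite -eu; apply/permPl/perm_rot.
have pv : perm_eq (i :: v) y by rewrite -ev; apply/permPl/perm_rot.
have puv : perm_eq u v.
  by rewrite -(perm_cons i); apply: perm_trans pu _; apply: perm_trans xy _; rewrite perm_sym.
have uu : uniq (i :: u) by rewrite (perm_uniq pu).
apply: rst_trans (cyclic_equiv_rot k x) _; apply/rst_sym.
apply: rst_trans (cyclic_equiv_rot l y) _; apply/rst_sym; rewrite eu ev.
apply: cyclic_equiv_cons => //.
  apply: IH => //; last by case/andP: uu.
  by move: szx; rewrite -(perm_size pu).
apply/allP => j ju; rewrite ltn_neqAle imax ?andbT.
  by apply: contraTneq uu => /val_inj <-; rewrite /= ju.
by rewrite -(perm_mem pu) inE ju orbT.
Qed.

(** * Conjugacy of cyclically equivalent words *)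

Lemma conjugate_refl w : conjugate w w.
Proof. by exists 1; rewrite conjg1. Qed.

Lemma conjugate_sym w w' : conjugate w w' -> conjugate w' w.
Proof. by case=> g ->; exists g^-1; rewrite conjgK. Qed.

Lemma conjugate_trans w1 w2 w3 : conjugate w1 w2 -> conjugate w2 w3 -> conjugate w1 w3.
Proof. by case=> g -> [h ->]; exists (g * h); rewrite conjgM. Qed.

Lemma cyclic_equiv_conjugate x y :
  cyclic_comm_equiv x y -> conjugate (word_prod x) (word_prod y).
Proof.
elim=> {x y} [x y [xy|[i [u [-> ->]]]]|x|x y _|x z y _ xz _ zy].
- by rewrite (comm_equiv_prod (rt_step _ _ _ _ xy)); exact: conjugate_refl.
- exists (gen i); rewrite -cats1 word_prod_cat word_prod1 word_prod_cons.
  by rewrite conjgE -mulgA mulKg.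
- exact: conjugate_refl.
- exact: conjugate_sym.
- exact: conjugate_trans xz zy.
Qed.

End Words.

(** * The presentation of the symmetric group *)

Section Presentation.
Variable n : nat.
Implicit Types (i j l : 'I_n) (x y z u v : seq 'I_n) (p q : 'I_n.+1).
Implicit Types (w : cox n) (s t : {perm 'I_n.+1}).

(** Indices out of range give the empty word, so that [descent] can compute with natural numbers. *)
Definition letter (i : nat) : seq 'I_n := if insub i is Some j then [:: j] else [::].

Lemma letterE (i : nat) : i < n -> exists2 j, letter i = [:: j] & j = i :> nat.
Proof. by move=> lin; rewrite /letter insubT; eexists. Qed.

(* The word k-1, k-2, ..., k-m: minimal coset representatives of the parabolic
   subgroup generated by 0, ..., k-2 in the one generated by 0, ..., k-1. *)
Fixpoint descent k m : seq 'I_n :=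
  if m is m'.+1 then descent k m' ++ letter (k - m) else [::].

Lemma descent_letters k m i : k <= n -> m <= k -> i \in descent k m -> k - m <= i < k.
Proof.
move=> kn; elim: m => //= m IH mk; rewrite mem_cat => /orP[/(IH (ltnW mk))|]; first lia.
have [|j -> jE] := @letterE (k - m.+1); first lia.
by rewrite inE => /eqP ->; lia.
Qed.

(** Moving left, [j] commutes with the letters below [i], turns into [i] by a braid relation at the
    factor [j], [i], and then commutes with the letters above [j]. *)
Lemma descent_pass k m i j : k <= n -> m <= k -> i.+1 = j -> k - m <= i -> j < k ->
  word_prod (descent k m) * gen j = gen i * word_prod (descent k m).
Proof.
move=> kn; elim: m => [|m IH] mk ij mi jk; first lia.
have [|l /= -> lE] := @letterE (k - m.+1); first lia.
rewrite word_prod_cat word_prod1.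
have [mi'|im] := leqP (k - m) i.
  have -> : word_prod (descent k m) * gen l * gen j = word_prod (descent k m) * gen j * gen l.
    by rewrite -!mulgA (gen_far (i := l)) // /far; lia.
  by rewrite (IH (ltnW mk)) // mulgA.
have -> : l = i by apply: ord_inj; lia.
case: m {IH} mk mi im lE => [|m] mk mi im lE; first lia.
have [|j' /= -> jE] := @letterE (k - m.+1); first lia.
have -> : j' = j by apply: ord_inj; lia.
rewrite word_prod_cat word_prod1 -!mulgA -gen_braid; last by rewrite /near ij eqxx.
rewrite !mulgA; congr (_ * _ * _); apply/esym/gen_far_word/allP => h /descent_letters.
by rewrite /far; lia.
Qed.

(** A letter appended after the descending word, whose last letter is k - m, does one of four
    things: it commutes through into [y], extends the descent, cancels its last letter, or passes
    through and enters [y] lowered by one. *)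
Lemma descent_normal_form k x : k <= n -> all (fun i : 'I_n => i < k) x ->
  exists y m, [/\ m <= k, all (fun i : 'I_n => i.+1 < k) y
    & word_prod x = word_prod y * word_prod (descent k m)].
Proof.
move=> kn; elim/last_ind: x => [_|x i IH].
  by exists [::], 0; rewrite word_prod_nil mulg1.
rewrite all_rcons => /andP[ik /IH[y [m [mk yk ex]]]].
rewrite -cats1 word_prod_cat word_prod1 {}ex.
have [im|] := ltnP i.+1 (k - m).
  exists (rcons y i), m; split=> //; first by rewrite all_rcons yk andbT; lia.
  rewrite -cats1 word_prod_cat word_prod1 -!mulgA; congr (_ * _).
  by apply/esym/gen_far_word/allP => h /descent_letters; rewrite /far; lia.
rewrite leq_eqVlt ltnS => /orP[/eqP im|].
  exists y, m.+1; split=> //; first lia.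
  have [|l /= -> lE] := @letterE (k - m.+1); first lia.
  rewrite word_prod_cat word_prod1 mulgA; congr (_ * gen _).
  by apply: ord_inj; lia.
rewrite leq_eqVlt => /orP[/eqP im|im].
  case: m mk im => [|m] mk im; first lia.
  exists y, m; split=> //; first lia.
  have [|l /= -> lE] := @letterE (k - m.+1); first lia.
  have -> : l = i by apply: ord_inj; lia.
  by rewrite word_prod_cat word_prod1 -!mulgA gen_sq mulg1.
have [|h _ hE] := @letterE i.-1; first lia.
exists (rcons y h), m; split=> //; first by rewrite all_rcons yk andbT; lia.
rewrite -cats1 word_prod_cat word_prod1 -!mulgA (descent_pass (i := h)) //; lia.
Qed.

Lemma word_perm_descent k m p : k <= n -> m <= k -> p = k :> nat ->
  word_perm (descent k m) p = k - m :> nat.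
Proof.
move=> kn; elim: m => [|m IH] mk pk; first by rewrite word_perm_nil perm1 subn0.
have [|l /= -> lE] := @letterE (k - m.+1); first lia.
rewrite word_perm_cat word_perm_cons word_perm_nil mulg1 permM simple_permE IH //; last lia.
by do 2?[case: eqP => //]; lia.
Qed.

(** Induction on the number of available generators: in the normal form [y] fixes the top point and
    the descent lowers it by [m], so a trivial permutation forces [m = 0] and leaves a word in fewer
    generators. *)
Lemma word_perm_ker x : word_perm x = 1 -> word_prod x = 1.
Proof.
suff ker_below k : k <= n -> all (fun i : 'I_n => i < k) x -> word_perm x = 1 -> word_prod x = 1.
  by apply: (ker_below n) => //; apply/allP => i _.
elim: k x => [|k IH] x kn xk x1.
  by case: x xk {x1} => //; rewrite word_prod_nil.
have [y [m [mk yk e]]] := descent_normal_form kn xk.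
have p1 : word_perm x = word_perm (y ++ descent k.+1 m).
  by apply: word_prod_perm; rewrite word_prod_cat.
pose p : 'I_n.+1 := inord k.+1; have pE : p = k.+1 :> nat by rewrite inordK.
have m0 : m = 0.
  have := congr1 (fun s : {perm 'I_n.+1} => nat_of_ord (s p)) p1.
  rewrite /= x1 perm1 word_perm_cat permM (word_perm_fix (x := y)); last by rewrite pE.
  by rewrite word_perm_descent // pE; lia.
rewrite m0 /= word_prod_nil mulg1 in e; rewrite m0 /= cats0 x1 in p1.
by rewrite e IH //; lia.
Qed.

Lemma word_perm_inj x y : word_perm x = word_perm y -> word_prod x = word_prod y.
Proof.
have rev_prod z : word_prod (rev z) = (word_prod z)^-1.
  elim: z => [|i z IH]; first by rewrite word_prod_nil invg1.
  by rewrite rev_cons -cats1 word_prod_cat IH word_prod1 word_prod_cons invMg genV.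
have rev_perm z : word_perm (rev z) = (word_perm z)^-1.
  elim: z => [|i z IH]; first by rewrite word_perm_nil invg1.
  rewrite rev_cons -cats1 word_perm_cat IH !word_perm_cons word_perm_nil mulg1.
  by rewrite invMg tpermV.
move=> xy; apply: (mulIg (word_prod y)^-1); rewrite mulgV -rev_prod -word_prod_cat.
by apply: word_perm_ker; rewrite word_perm_cat rev_perm xy mulgV.
Qed.

(** The transpositions of 0 with k generate the symmetric group. The one with k = 1 is a generator,
    and each further one is obtained by conjugating its predecessor by a generator. *)
Lemma word_perm_onto s : exists x, s = word_perm x.
Proof.
pose G : {set {perm 'I_n.+1}} := <<[set simple_perm i | i : 'I_n]>>.
have simple_G i : simple_perm i \in G by apply/mem_gen/imset_f.
have li i : widen_ord (leqnSn n) i = inord i by apply: ord_inj; rewrite inordK //= ltnS ltnW.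
have ri i : lift ord0 i = inord i.+1 by apply: ord_inj; rewrite lift0 inordK // ltnS.
have tperm_G (k : nat) : k <= n -> tperm ord0 (inord k) \in G.
  elim: k => [_|k IH kn].
    by rewrite (_ : inord 0 = ord0) ?tperm1 ?group1 //; apply: ord_inj; rewrite inordK.
  case: k IH kn => [|k] IH kn.
    have := simple_G (Ordinal kn); rewrite /simple_perm li ri (_ : inord 0 = ord0) //.
    by apply: ord_inj; rewrite inordK.
  have -> : tperm ord0 (inord k.+2) =
      tperm ord0 (inord k.+1) ^ simple_perm (Ordinal kn) :> {perm 'I_n.+1}.
    rewrite tpermJ /simple_perm li ri tpermL tpermD //.
      by rewrite -val_eqE /= inordK //; lia.
    by rewrite -val_eqE /= inordK //; lia.
  by rewrite groupJ // IH // ltnW.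
have : s \in G.
  have := in_setT s; rewrite -(gen_tperm ord0) => sT; apply: subsetP sT => /=.
  rewrite gen_subG; apply/subsetP => _ /imsetP[p _ ->].
  by rewrite -(inord_val p) tperm_G // -ltnS.
case/gen_prodgP => m [c cP ->]; elim: m c cP => [|m IH] c cP.
  by exists [::]; rewrite big_ord0 word_perm_nil.
rewrite big_ord_recl; have [/= y ->] := IH (fun h => c (lift ord0 h)) (fun h => cP _).
have /imsetP[i _ ->] := cP ord0; exists (i :: y); by rewrite word_perm_cons.
Qed.

Lemma conjugate_word_perm x y :
  conjugate (word_prod x) (word_prod y) <-> exists s, word_perm y = word_perm x ^ s.
Proof.
split=> [[g e]|[s e]].
  have [z gz] := word_prod_onto g; exists (word_perm z).
  apply: (mulgI (word_perm z)); rewrite -conjgC -!word_perm_cat; apply: word_prod_perm.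
  by rewrite !word_prod_cat e gz -conjgC.
have [z sz] := word_perm_onto s; exists (word_prod z).
apply: (mulgI (word_prod z)); rewrite -conjgC -!word_prod_cat; apply: word_perm_inj.
by rewrite !word_perm_cat e sz -conjgC.
Qed.

End Presentation.

(** * Cycle types *)

Section CycleType.
Variable T : finType.
Implicit Types (s t g : {perm T}) (x y : T) (O : {set T}).

Lemma porbit_in_porbits s x : porbit s x \in porbits s.
Proof. exact: imset_f. Qed.

(** Exponents may be reduced modulo the orbit length, below which the iterates are distinct. *)
Lemma expg_porbit_eq s x a b :
  ((s ^+ a) x == (s ^+ b) x) = (a == b %[mod #|porbit s x|]).
Proof.
set m := #|porbit s x|.
have m_gt0 : 0 < m by rewrite lt0n card_porbit_neq0.
have red k : (s ^+ k) x = nth x (traject s x m) (k %% m).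
  rewrite nth_traject ?ltn_mod // -permX {1}(divn_eq k m) expgD permM.
  congr ((s ^+ _) _); elim: (k %/ m) => [|q IH]; first by rewrite perm1.
  by rewrite mulSn expgD permM [(s ^+ m) x]permX iter_porbit.
by rewrite !red nth_uniq ?size_traject ?ltn_mod // uniq_traject_porbit.
Qed.

Lemma porbit_conj s g x : porbit (s ^ g) (g x) = g @: porbit s x.
Proof.
apply/setP => y; apply/porbitP/imsetP => [[k ->]|[_ /porbitP[k ->] ->]].
  by exists ((s ^+ k) x); rewrite ?mem_porbit // -conjXg permJ.
by exists k; rewrite -conjXg permJ.
Qed.

(** With a base point in each orbit and in its image under [phi], the conjugator sends the k-th
    iterate of one base point under [s] to the k-th iterate of the other under [t]; equal orbit
    lengths make this consistent. *)
Lemma conj_of_porbits s t (phi : {set T} -> {set T}) :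
  {in porbits s &, injective phi} ->
  (forall O, O \in porbits s -> phi O \in porbits t /\ #|phi O| = #|O|) ->
  exists g, t = s ^ g.
Proof.
move=> phi_inj phiP.
(* The base points depend on the orbit alone; the default [x] is never reached, since orbits are
   nonempty. *)
pose r x := odflt x [pick y in porbit s x].
pose r' x := odflt x [pick y in phi (porbit s x)].
have rP x : porbit s (r x) = porbit s x.
  rewrite /r; case: pickP => [y|/(_ x)]; last by rewrite porbit_id.
  by move=> xy; apply/eqP; rewrite eq_porbit_mem.
have phi_orb x := phiP _ (porbit_in_porbits s x).
have r'P x : porbit t (r' x) = phi (porbit s x).
  have [/imsetP[y _ e] _] := phi_orb x.
  rewrite /r' e; case: pickP => [z|/(_ y)]; last by rewrite porbit_id.
  by move=> xy; apply/eqP; rewrite eq_porbit_mem.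
have r_eq x y : porbit s x = porbit s y -> r x = r y.
  rewrite /r => e; rewrite e; case: pickP => // /(_ y); by rewrite porbit_id.
have r'_eq x y : porbit s x = porbit s y -> r' x = r' y.
  move=> e; have := r'P y; rewrite /r' e; case: pickP => // /(_ (r' y)).
  by rewrite -r'P porbit_id.
have [K KP] : exists K : T -> nat, forall x, (s ^+ K x) (r x) = x.
  apply: (@fin_all_exists T (fun=> nat) (fun x k => (s ^+ k) (r x) = x)) => x.
  have : x \in porbit s (r x) by rewrite rP porbit_id.
  by case/porbitP => k e; exists k.
have key x a b : ((t ^+ a) (r' x) == (t ^+ b) (r' x)) = ((s ^+ a) (r x) == (s ^+ b) (r x)).
  by rewrite !expg_porbit_eq r'P rP (phi_orb x).2.
pose f x := (t ^+ K x) (r' x).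
have f_inj : injective f.
  move=> x y fxy; have e : porbit s x = porbit s y.
    apply: phi_inj; rewrite ?porbit_in_porbits //.
    by rewrite -!r'P -(porbit_perm t (K x)) -/(f x) fxy porbit_perm.
  apply/eqP; rewrite -(KP x) -(KP y) (r_eq _ _ e) -key -(r'_eq _ _ e).
  by rewrite -/(f x) fxy /f (r'_eq _ _ e).
exists (perm f_inj); apply: (mulgI (perm f_inj)); rewrite -conjgC.
apply/permP => x; rewrite !permM !permE.
have e : porbit s (s x) = porbit s x by rewrite (porbit_perm s 1).
(* The exponents [K (s x)] and [(K x).+1] may differ by a multiple of the orbit length, so [key]
   transfers the comparison from [t] back to [s]. *)
rewrite /f (r'_eq _ _ e) -permM -expgSr; apply/eqP.
by rewrite eq_sym key -{1}(r_eq _ _ e) KP expgSr permM KP.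
Qed.

End CycleType.

Definition size_count (T : finType) (A : {set {set T}}) (m : nat) : nat :=
  #|[set O in A | #|O| == m]|.

(** Given equal counts, the members of each size are enumerated on both sides and matched by
    position; the default [set0] is never reached because the lists have equal length. *)
Lemma size_count_map (T U : finType) (A : {set {set T}}) (B : {set {set U}}) :
  (forall m, size_count A m = size_count B m) <->
  exists phi : {set T} -> {set U},
    [/\ {in A &, injective phi}, phi @: A = B & forall O, O \in A -> #|phi O| = #|O|].
Proof.
split=> [AB|[phi [phi_inj <- phi_card]] m]; last first.
  rewrite /size_count -(card_in_imset (f := phi) (D := [set O in A | #|O| == m])).
    congr #|pred_of_set _|; apply/setP => O; apply/imsetP/idP.
      by case=> O'; rewrite inE => /andP[AO' sO'] ->; rewrite inE imset_f // phi_card.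
    rewrite inE => /andP[/imsetP[O' AO' ->]]; rewrite phi_card // => sO'.
    by exists O'; rewrite // inE AO'.
  by move=> O O' /setIdP[AO _] /setIdP[AO' _]; apply: phi_inj.
pose A_ (m : nat) := enum [set O in A | #|O| == m].
pose B_ (m : nat) := enum [set O in B | #|O| == m].
have sAB m : size (A_ m) = size (B_ m) by rewrite -!cardE; apply: AB.
pose phi (O : {set T}) := nth set0 (B_ #|O|) (index O (A_ #|O|)).
pose psi (O : {set U}) := nth set0 (A_ #|O|) (index O (B_ #|O|)).
have mem_A (O : {set T}) : O \in A -> O \in A_ #|O| by move=> AO; rewrite mem_enum inE AO eqxx.
have mem_B (O : {set U}) : O \in B -> O \in B_ #|O| by move=> AO; rewrite mem_enum inE AO eqxx.
have phiP (O : {set T}) : O \in A -> phi O \in B /\ #|phi O| = #|O|.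
  move=> AO; suff : phi O \in B_ #|O| by rewrite mem_enum inE => /andP[? /eqP].
  by rewrite mem_nth // -sAB index_mem mem_A.
have psiP (O : {set U}) : O \in B -> psi O \in A /\ #|psi O| = #|O|.
  move=> AO; suff : psi O \in A_ #|O| by rewrite mem_enum inE => /andP[? /eqP].
  by rewrite mem_nth // sAB index_mem mem_B.
exists phi; split=> [O O' AO AO' e||O /phiP[]//].
  have eO : #|O| = #|O'| by rewrite -(phiP O AO).2 e (phiP O' AO').2.
  have mO : O \in A_ #|O'| by rewrite -eO mem_A.
  have mO' := mem_A _ AO'; move/eqP: e; rewrite /phi eO.
  rewrite nth_uniq ?enum_uniq -?sAB ?index_mem // => /eqP e.
  by rewrite -(nth_index set0 mO) e nth_index.
apply/setP => O; apply/imsetP/idP => [[O' /phiP[? _] -> //]|BO].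
have [Apsi cpsi] := psiP _ BO; exists (psi O) => //.
rewrite /phi cpsi /psi index_uniq ?enum_uniq ?nth_index ?mem_B //.
by rewrite sAB index_mem mem_B.
Qed.

(** * Conjugacy of permutations by cycle type *)

Section Conjugacy.
Variable T : finType.
Implicit Types (s t g : {perm T}).

Lemma perm_conj_cycle_type s t :
  (exists g, t = s ^ g) <-> forall m, size_count (porbits s) m = size_count (porbits t) m.
Proof.
split=> [[g ->]|/size_count_map[phi [phi_inj phi_im phi_card]]]; last first.
  apply: (conj_of_porbits phi_inj) => O sO; split; last exact: phi_card.
  by rewrite -phi_im imset_f.
apply/size_count_map; exists (fun O : {set T} => g @: O); split.
- by move=> O O' _ _; apply/imset_inj/perm_inj.
- apply/setP => O; apply/imsetP/imsetP => [[_ /imsetP[x _ ->] ->]|[x _ ->]].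
    by exists (g x); rewrite // porbit_conj.
  exists (porbit s (g^-1 x)); first exact: porbit_in_porbits.
  by rewrite -porbit_conj permKV.
by move=> O _; rewrite card_imset //; apply: perm_inj.
Qed.

Lemma size_count_porbits0 s : size_count (porbits s) 0 = 0.
Proof.
apply/eqP; rewrite cards_eq0; apply/eqP/setP => O; rewrite !inE.
by apply/negP => /andP[/imsetP[x _ ->]]; apply/negP/card_porbit_neq0.
Qed.

(** The orbits partition [T] and are grouped by size. The bound exceeds every orbit size and leaves
    the terms 0 and 1 to be split off even when [T] is empty. *)
Lemma sum_size_count_porbits s :
  \sum_(m < #|T|.+2) m * size_count (porbits s) m = #|T|.
Proof.
have part : partition (porbits s) [set: T].
  apply/and3P; split.
  - apply/eqP/setP => x; rewrite inE; apply/bigcupP; exists (porbit s x); last exact: porbit_id.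
    exact: porbit_in_porbits.
  - apply/trivIsetP => _ _ /imsetP[x _ ->] /imsetP[y _ ->] ne.
    apply/pred0P => z /=; apply/negP => /andP[]; rewrite -!eq_porbit_mem => /eqP xz /eqP yz.
    by move: ne; rewrite -xz yz eqxx.
  - by apply/negP => /imsetP[x _ /setP/(_ x)]; rewrite porbit_id inE.
rewrite -[RHS]cardsT (card_partition part).
rewrite (partition_big (fun O : {set T} => inord #|O| : 'I_#|T|.+2) predT) //=.
apply: eq_bigr => m _; rewrite /size_count mulnC -sum_nat_const.
have inE_card (O : {set T}) : (inord #|O| == m :> 'I_#|T|.+2) = (#|O| == m).
  by rewrite -val_eqE /= inordK // ltnS; apply/leqW/max_card.
rewrite [RHS](eq_bigr (fun=> m : nat)); last by move=> O; rewrite inE_card => /andP[_ /eqP].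
by apply: eq_bigl => O; rewrite inE inE_card.
Qed.

(* The number of fixed points is determined by the other cycle lengths. *)
Lemma cycle_type_nontrivial s t :
  (forall m, size_count (porbits s) m.+2 = size_count (porbits t) m.+2) ->
  forall m, size_count (porbits s) m = size_count (porbits t) m.
Proof.
move=> st [|[|m]] //; first by rewrite !size_count_porbits0.
have := sum_size_count_porbits s; rewrite -[in RHS](sum_size_count_porbits t).
rewrite !big_ord_recl /= !mul0n !add0n !mul1n => /eqP.
by under eq_bigr do rewrite st; rewrite eqn_add2r => /eqP.
Qed.

End Conjugacy.

(** * Runs of generators and cycles *)

Section Runs.
Variable n : nat.
Implicit Types (i j k : 'I_n) (x y z : seq 'I_n) (p q : 'I_n.+1).
Implicit Types (S I : {set 'I_n}) (O : {set 'I_n.+1}) (s : {perm 'I_n.+1}).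

Definition near_in S : rel 'I_n := fun i j => [&& i \in S, j \in S & near i j].

(** For [i] in [S], the maximal interval of [S] around [i]; encoding it by connectivity allows
    comparison with both permutation orbits and Hasse diagram components. *)
Definition run S i : {set 'I_n} := [set j | connect (near_in S) i j].

Definition runs S : {set {set 'I_n}} := [set run S i | i in S].

Lemma near_in_sym S : symmetric (near_in S).
Proof. by move=> i j; rewrite /near_in nearC andbCA. Qed.

Lemma run_sub S i : i \in S -> run S i \subset S.
Proof.
move=> iS; apply/subsetP => j; rewrite inE.
have cl : closed (near_in S) (mem S) by move=> a b /and3P[/= -> ->].
by move/(closed_connect cl) <-.
Qed.

Lemma run_refl S i : i \in run S i.
Proof. by rewrite inE connect0. Qed.

Local Notation lo i := (widen_ord (leqnSn n) i).
Local Notation hi i := (lift ord0 i).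

Lemma word_perm_fix_low x p : all (fun i : 'I_n => p < i) x -> word_perm x p = p.
Proof.
elim: x => [_|i x IH /= /andP[ip /IH e]]; first by rewrite word_perm_nil perm1.
rewrite word_perm_cons permM (_ : simple_perm i p = p) //.
apply: ord_inj; rewrite simple_permE.
by case: eqP => [|_]; [|case: eqP => // ?]; lia.
Qed.

(** The letters before [i] are smaller and fix i + 1, the letter [i] sends it to i, and the larger
    letters after it fix i. *)
Lemma sorted_word_perm z i :
  sorted (fun j k : 'I_n => j < k) z -> i \in z -> word_perm z (hi i) = lo i.
Proof.
rewrite sorted_pairwise => [|a b c]; last exact: ltn_trans.
move=> sz iz; case/splitPr: iz sz => a b.
rewrite pairwise_cat /= => /and4P[/allrelP ab _ ib _].
rewrite word_perm_cat word_perm_cons !permM (word_perm_fix (x := a)); last first.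
  by apply/allP => j ja; rewrite lift0 ltnS; apply: ab; rewrite ?mem_head.
rewrite /simple_perm tpermR word_perm_fix_low //.
Qed.

(** * Orbits of an increasing product *)

Section Orbits.
Variable z : seq 'I_n.
Hypothesis sz : sorted (fun j k : 'I_n => j < k) z.
Let s := word_perm z.
Let S := [set i in z].

Lemma porbit_step i : i \in S -> lo i \in porbit s (hi i).
Proof. by rewrite inE => iz; rewrite -(sorted_word_perm sz iz) (mem_porbit s 1). Qed.

Lemma porbit_initial i p q : i \notin S -> q \in porbit s p -> (q <= i) = (p <= i).
Proof.
rewrite inE => iz /porbitP[k ->]; elim: k => [|k IH]; first by rewrite perm1.
by rewrite expgSr permM (stabilises_word iz).
Qed.

(** Consecutive generators share a point, so a run stays in one orbit. Conversely, a missing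
    generator k between [i] and [j] makes {0, ..., k} invariant and separates the two points. *)
Lemma connect_porbit i j : i \in S -> j \in S ->
  connect (near_in S) i j = (lo j \in porbit s (lo i)).
Proof.
move=> iS jS; apply/idP/idP.
  have cl : closed (near_in S) [pred k | lo k \in porbit s (lo i)].
    move=> a b /and3P[aS bS ab]; rewrite !inE -!eq_porbit_mem.
    wlog {ab} ab : a b aS bS / a.+1 = b.
      move=> h; case/orP: ab => /eqP ab; first exact: h.
      by apply/esym; apply: h.
    have -> : lo b = hi a by apply: ord_inj; rewrite lift0.
    by move: (porbit_step aS); rewrite -eq_porbit_mem => /eqP ->.
  by move/(closed_connect cl); rewrite !inE porbit_id => <-.
wlog ij : i j iS jS / i <= j.
  move=> h; case: (leqP i j) => [/h|/ltnW /h]; first exact.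
  rewrite porbit_sym sym_connect_sym //; last exact: near_in_sym.
  exact.
move=> orb; have between k : i <= k < j -> k \in S.
  move=> ikj; apply: contraTT orb => kS; apply/negP => /(porbit_initial kS) /=; lia.
move: ij; rewrite leq_eqVlt => /orP[/eqP/ord_inj->|ij]; first exact: connect0.
have {orb}: forall m, i + m <= j -> forall k, k = i + m :> nat -> connect (near_in S) i k.
  elim=> [_ k ki|m IH mj k km].
    by rewrite (_ : k = i) ?connect0 //; apply: ord_inj; lia.
  have lt_n : i + m < n by apply: leq_trans (ltn_ord j); lia.
  apply: (connect_trans (IH _ (Ordinal lt_n) erefl)); first lia.
  apply/connect1/and3P; split; first by apply: between => /=; lia.
    have [->//|kj] := eqVneq k j; apply: between.
    by have {kj}: k != j :> nat by []; lia.
  by apply/orP; left; rewrite /= km addnS.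
by move/(_ (j - i)); apply; lia.
Qed.

Definition orbit_labels O := [set i in S | lo i \in O].

Lemma lo_inj : injective (fun i => lo i).
Proof. by move=> i j /(congr1 (@nat_of_ord _)) /= /ord_inj. Qed.

(* The largest point of an orbit is the only one which is not the lower end
   of a generator in the support. *)
Lemma card_orbit_labels O : O \in porbits s -> #|O| = #|orbit_labels O|.+1.
Proof.
case/imsetP => p0 _ ->; set O0 := porbit s p0.
have [e eO emax] : exists2 e, e \in O0 & forall q, q \in O0 -> q <= e.
  case: (@arg_maxnP _ p0 (mem O0) (fun q => q : nat) (porbit_id s p0)) => e eO emax.
  by exists e.
have step i : i \in S -> (hi i \in O0) = (lo i \in O0).
  by move=> /porbit_step; rewrite /O0 -!eq_porbit_mem => /eqP ->.
have eS i : i \in S -> lo i != e.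
  move=> iS; apply/eqP => ie; have := emax (hi i); rewrite step // ie => /(_ eO).
  by rewrite -ie lift0 /= ltnn.
rewrite (cardsD1 e) eO add1n; congr _.+1.
rewrite -(card_imset _ lo_inj); congr #|pred_of_set _|.
apply/setP => q; rewrite !inE; apply/andP/imsetP => [[qe qO]|[i]]; last first.
  by rewrite !inE -[i \in z](in_set (mem z)) => /andP[iS iO] ->; rewrite eS.
have q_lt_e : q < e by rewrite ltn_neqAle emax // andbT.
have qn : q < n by apply: leq_trans q_lt_e _; rewrite -ltnS.
have ql : q = lo (Ordinal qn) by apply: ord_inj.
exists (Ordinal qn) => //; rewrite inE -ql qO andbT.
(* If generator [q] were missing, {0, ..., q} would be invariant and would separate [q] from the
   larger point [e] of its orbit. *)
apply/negPn/negP => qS; have := porbit_initial qS (_ : e \in porbit s q).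
have -> : porbit s q = O0 by apply/eqP; rewrite eq_porbit_mem.
by move=> /(_ eO) /=; lia.
Qed.

Lemma orbit_labels_run i : i \in S -> orbit_labels (porbit s (lo i)) = run S i.
Proof.
move=> iS; apply/setP => j; rewrite !inE.
have [jS|jS] := boolP (j \in S).
  by rewrite (connect_porbit iS jS); move: jS; rewrite inE => ->.
have -> : (j \in z) = false by apply: contraNF jS; rewrite inE.
by apply/esym; apply: contraNF jS => ij; apply: (subsetP (run_sub iS)); rewrite inE.
Qed.

(** [orbit_labels] matches nontrivial orbits with runs: it drops the largest point, and an orbit
    with at least two points is recovered from any of its labels. *)
Lemma size_count_runs m : size_count (runs S) m.+1 = size_count (porbits s) m.+2.
Proof.
rewrite /size_count -(card_in_imset (f := orbit_labels) (D := [set O in porbits s | #|O| == m.+2])).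
  congr #|pred_of_set _|; apply/setP => I; apply/idP/imsetP.
    rewrite inE => /andP[/imsetP[i iS ->] cI]; exists (porbit s (lo i)); last first.
      by rewrite orbit_labels_run.
    rewrite inE porbit_in_porbits card_orbit_labels ?porbit_in_porbits //.
    by rewrite orbit_labels_run // eqSS.
  case=> O /setIdP[Os]; rewrite card_orbit_labels // eqSS => cO ->.
  rewrite inE cO andbT.
  have /set0Pn[i] : orbit_labels O != set0 by rewrite -card_gt0 (eqP cO).
  rewrite inE => /andP[iS iO]; case/imsetP: Os iO => p _ -> ip.
  have <- : porbit s (lo i) = porbit s p by apply/eqP; rewrite eq_porbit_mem.
  by rewrite orbit_labels_run // imset_f.
move=> O O' /setIdP[Os cO] /setIdP[Os' _] e.
have /set0Pn[i iO] : orbit_labels O != set0.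
  by move: cO; rewrite -card_gt0 card_orbit_labels // eqSS => /eqP ->.
have := iO; rewrite e; move: iO; rewrite !inE => /andP[_ iO] /andP[_ iO'].
case/imsetP: Os iO => p _ ->; case/imsetP: Os' iO' => p' _ ->.
by rewrite -!eq_porbit_mem => /eqP <- /eqP ->.
Qed.

End Orbits.

Lemma size_count_runs0 S : size_count (runs S) 0 = 0.
Proof.
apply/eqP; rewrite cards_eq0; apply/eqP/setP => I; rewrite !inE.
apply/negP => /andP[/imsetP[i _ ->]]; rewrite cards_eq0 => /eqP/setP/(_ i).
by rewrite run_refl inE.
Qed.

(** Each word is conjugate to the increasing word on its support, whose nontrivial cycle lengths are
    read off from the runs. *)
Lemma conjugate_runs x y : uniq x -> uniq y ->
  conjugate (word_prod x) (word_prod y) <->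
  forall m, size_count (runs [set i in x]) m = size_count (runs [set i in y]) m.
Proof.
have sorted_sort z : uniq z -> exists z', [/\ sorted (fun j k : 'I_n => j < k) z', perm_eq z z'
    & [set i in z] = [set i in z']].
  move=> uz; exists (sort (fun j k : 'I_n => j <= k) z).
  have p : perm_eq z (sort (fun j k : 'I_n => j <= k) z) by rewrite perm_sym perm_sort.
  split=> //; last by apply/setP => i; rewrite !inE (perm_mem p).
  rewrite -(sorted_map (f := @nat_of_ord n) (e' := ltn)).
  rewrite ltn_sorted_uniq_leq map_inj_uniq; last exact: ord_inj.
  rewrite sort_uniq uz sorted_map; apply: sort_sorted => j k; exact: leq_total.
move=> ux uy; have [x' [sx xx' ->]] := sorted_sort _ ux.
have [y' [sy yy' ->]] := sorted_sort _ uy.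
have cx := cyclic_equiv_conjugate (uniq_cyclic_equiv ux xx').
have cy := cyclic_equiv_conjugate (uniq_cyclic_equiv uy yy').
split=> [xy|counts].
  have : conjugate (word_prod x') (word_prod y').
    exact: conjugate_trans (conjugate_sym cx) (conjugate_trans xy cy).
  move/conjugate_word_perm/perm_conj_cycle_type => counts [|m]; first by rewrite !size_count_runs0.
  by rewrite !size_count_runs.
apply: conjugate_trans cx (conjugate_trans _ (conjugate_sym cy)).
apply/conjugate_word_perm/perm_conj_cycle_type/cycle_type_nontrivial => m.
by rewrite -!size_count_runs.
Qed.

End Runs.

(** * Heaps of words without repetition *)

Lemma connect_map (T U : finType) (f : T -> U) (e : rel T) (e' : rel U) :
  (forall a b, e a b -> connect e' (f a) (f b)) ->
  forall a b, connect e a b -> connect e' (f a) (f b).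
Proof.
move=> ee' a _ /connectP[p ep ->]; elim: p a ep => [|c p IH] a /=; first by rewrite connect0.
by case/andP=> /ee' ac /IH; apply: connect_trans.
Qed.

Lemma connect_lift (T U : finType) (f : T -> U) (e : rel T) (e' : rel U) :
  injective f ->
  (forall a b', e' (f a) b' -> exists2 b, b' = f b & connect e a b) ->
  forall a b, connect e' (f a) (f b) -> connect e a b.
Proof.
move=> f_inj e'e a b /connectP[p e'p fb]; elim: p a e'p fb => [|c p IH] a /=.
  by move=> _ /f_inj ->; exact: connect0.
by case/andP=> /e'e[c' -> ac'] /IH h /h; apply: connect_trans.
Qed.

Lemma connect_restrict (T : finType) (P : pred T) (e e' : rel T) :
  (forall a b, P a -> e a b -> P b /\ e' a b) ->
  forall a b, P a -> connect e a b -> connect e' a b.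
Proof.
move=> ee' a _ Pa /connectP[p ep ->]; elim: p a Pa ep => [|c p IH] a Pa /=.
  by rewrite connect0.
case/andP=> ac; have [Pc e'ac] := ee' _ _ Pa ac.
by move/(IH _ Pc); apply: connect_trans (connect1 e'ac).
Qed.

Lemma subseq_pair (T : eqType) (a : T) (s : seq T) i j :
  uniq s -> i < size s -> j < size s -> i != j ->
  subseq [:: nth a s i; nth a s j] s = (i < j).
Proof.
move=> us si sj ij; have := mem2E s (nth a s i) (nth a s j).
rewrite nth_uniq // (negPf ij) => <-; rewrite /mem2 index_uniq //.
rewrite ltn_neqAle ij /=; case: (leqP i j) => [le_ij|lt_ji].
  by rewrite -{1}(subnKC le_ij) -nth_drop mem_nth // size_drop ltn_sub2r // (leq_ltn_trans le_ij).
have := us; rewrite -{1}(cat_take_drop i s) cat_uniq => /and3P[_ /hasPn h _].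
by apply/negP => /h; rewrite -(nth_take a lt_ji) mem_nth // size_take si.
Qed.

Section Heaps.
Variable n : nat.
Implicit Types (i j k : 'I_n) (x y z u v : seq 'I_n) (H K C D : lposet n) (S I : {set 'I_n}).

Lemma gen_commute i j : (gen i * gen j != gen j * gen i) = near i j.
Proof.
have [->|ij] := eqVneq i j; first by rewrite eqxx /near; lia.
have [nij|fij] := boolP (near i j); last first.
  by rewrite gen_far ?eqxx // farP.
wlog {nij} nij : i j ij / i.+1 = j.
  move=> h; case/orP: nij => /eqP nij; first exact: h.
  by rewrite eq_sym; apply: h; rewrite // eq_sym.
(* The two products send the point i to i + 2 and to i + 1 respectively. *)
apply/eqP; rewrite -!word_prod1 -!word_prod_cat => /word_prod_perm/permP.
move/(_ (widen_ord (leqnSn n) i))/(congr1 (@nat_of_ord _)).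
rewrite /= !word_perm_cons word_perm_nil !mulg1 !permM !simple_permE /= eqxx.
by do ![case: eqP => ? /=]; lia.
Qed.

(** The heap relation on labels: in a word without repetition, the subsequence condition says that
    [b] stands to the left of [a], hence above it. *)
Definition label_step z : rel 'I_n := fun a b => near a b && subseq [:: b; a] z.

Lemma label_step_mem z a b : label_step z a b -> (a \in z) && (b \in z).
Proof. by case/andP=> _ /mem_subseq h; rewrite !h ?inE ?eqxx ?orbT. Qed.

(* When no letter is repeated, blocks can be replaced by their labels, which
   spares explicit bijections between positions. *)
Definition models H z := [/\ uniq z, injective (@hlabel n H),
  forall i, i \in z <-> exists a : H, hlabel a = i
  & forall a b : H, hle a b = connect (label_step z) (hlabel a) (hlabel b)].

Lemma models_heap z : uniq z -> models (heap z) z.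
Proof.
move=> uz; have lab_inj : injective (tnth (in_tuple z)) by apply/tuple_uniqP.
have lab_mem i : i \in z <-> exists a, tnth (in_tuple z) a = i.
  by split=> [/(tnthP (in_tuple z))[a ->]|[a <-]]; [exists a|apply: mem_tnth].
have stepE a b : heap_step a b = label_step z (tnth (in_tuple z) a) (tnth (in_tuple z) b).
  rewrite /heap_step gen_commute nearC /label_step andbC.
  have [nab|//] := boolP (near _ _); rewrite /=.
  have ba : b != a by apply: contraTneq nab => ->; rewrite /near; lia.
  have d : 'I_n := tnth (in_tuple z) a.
  by rewrite !(tnth_nth d) subseq_pair.
split=> // a b; apply/idP/idP.
  by apply: connect_map => c d; rewrite stepE; apply: connect1.
apply: connect_lift => // c l cl; have /andP[_ /lab_mem[d dl]] := label_step_mem cl.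
by exists d => //; apply: connect1; rewrite stepE dl.
Qed.

Lemma lposet_iso_refl H : lposet_iso H H.
Proof. by exists id; split=> //; exists id. Qed.

Lemma lposet_iso_sym H K : lposet_iso H K -> lposet_iso K H.
Proof.
case=> f [[g fK gK] lf of_]; exists g; split; first by exists f.
  by move=> a; rewrite -lf gK.
by move=> a b; rewrite -of_ !gK.
Qed.

Lemma models_iso H K z : lposet_iso H K -> models K z -> models H z.
Proof.
case=> f [fbij lf of_] [uz Kinj Klab Kle]; split=> //.
- by move=> a b; rewrite -!lf => /Kinj/(bij_inj fbij).
- move=> i; split=> [/Klab[a <-]|[a <-]]; last by apply/Klab; exists (f a).
  by case: fbij => g _ gK; exists (g a); rewrite -lf gK.
- by move=> a b; rewrite -of_ Kle !lf.
Qed.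

Lemma models_lposet_iso H K z z' : models H z -> models K z' -> z =i z' ->
  label_step z =2 label_step z' -> lposet_iso H K.
Proof.
move=> [_ Hinj Hlab Hle] [_ Kinj Klab Kle] zz' ezz'.
have [f fl] : exists f : H -> K, forall a, hlabel (f a) = hlabel a.
  apply: (@fin_all_exists H (fun=> K) (fun a b => hlabel b = hlabel a)) => a.
  by apply/Klab; rewrite -zz'; apply/Hlab; exists a.
have [g gl] : exists g : K -> H, forall a, hlabel (g a) = hlabel a.
  apply: (@fin_all_exists K (fun=> H) (fun a b => hlabel b = hlabel a)) => a.
  by apply/Hlab; rewrite zz'; apply/Klab; exists a.
exists f; split=> //.
  by exists g => a; [apply: Hinj; rewrite gl fl|apply: Kinj; rewrite fl gl].
by move=> a b; rewrite Hle Kle !fl (eq_connect ezz').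
Qed.

(** * Cylindrical heaps and rings as label sets *)

Lemma heap_iso_models H z : uniq z -> lposet_iso H (heap z) <-> models H z.
Proof.
move=> uz; split=> [/models_iso|Hz]; first by apply; apply: models_heap.
exact: models_lposet_iso Hz (models_heap uz) _ _.
Qed.

(** The common description of rings and cylindrical heaps of CFC elements, by [ring_of_label_ring]
    and [cyl_heap_label_ring]. *)
Definition label_ring I : classical_sets.set (lposet n) :=
  fun H => exists2 z, [set i in z] = I & models H z.

Lemma label_ring_labels I H : label_ring I H -> [set hlabel a | a : H] = I.
Proof.
case=> z <- [_ _ Hlab _]; apply/setP => i; rewrite inE.
by apply/imsetP/idP => [[a _ ->]|/Hlab[a <-]]; [apply/Hlab|]; exists a.
Qed.

Lemma label_ring_card I H : label_ring I H -> nblocks H = #|I|.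
Proof.
move=> HI; rewrite -(label_ring_labels HI) card_imset ?card_ord //.
by case: HI => z _ [].
Qed.

Lemma label_ring_heap x : uniq x -> label_ring [set i in x] (heap x).
Proof. by move=> ux; exists x => //; apply: models_heap. Qed.

Lemma label_ring_enum I : label_ring I (heap (enum I)).
Proof.
exists (enum I); last by apply/models_heap/enum_uniq.
by apply/setP => i; rewrite inE mem_enum.
Qed.

Lemma label_ring_inj : injective label_ring.
Proof.
move=> I J IJ; have := label_ring_enum I; rewrite IJ => /label_ring_labels <-.
by rewrite (label_ring_labels (label_ring_enum I)).
Qed.

(** By [CFC_uniq] a cyclic shift only relates heaps of words without repetition, and it keeps their
    letters. *)
Lemma cyc_equiv_label_ring I H K : cyc_equiv H K -> label_ring I H <-> label_ring I K.
Proof.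
elim=> {H K} [H K|//|H K _ [? ?]|H D K _ [? ?] _ [? ?]]; [|by split|by split; auto].
case=> [HK|[w [i [u [cw rw HH KK]]]]].
  by split; case=> z zI /models_iso h; exists z => //; apply: h; [apply: lposet_iso_sym|].
have ux := CFC_uniq cw rw.
have ux' : uniq (rcons u i) by rewrite rcons_uniq.
have HR : label_ring [set j in i :: u] H.
  by exists (i :: u) => //; apply: models_iso HH (models_heap ux).
have KR : label_ring [set j in i :: u] K.
  exists (rcons u i); last by apply: models_iso KK (models_heap ux').
  by apply/setP => j; rewrite !inE mem_rcons.
split=> /label_ring_labels <-.
  by rewrite (label_ring_labels HR).
by rewrite (label_ring_labels KR).
Qed.

Lemma label_step_comm i j u v : far i j ->
  label_step (u ++ [:: i; j] ++ v) =2 label_step (u ++ [:: j; i] ++ v).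
Proof.
move=> ij a b; rewrite /label_step; have [nab|//] := boolP (near a b); rewrite /=.
(* Only the letters [a] and [b] matter; being neighbours, they cannot be the two commuting letters
   that are swapped. *)
have filterP x : subseq [:: b; a] x = subseq [:: b; a] (filter (pred2 a b) x).
  by rewrite subseq_filter /= !eqxx orbT.
rewrite filterP [in RHS]filterP !filter_cat /=.
case: (boolP ((i == a) || (i == b))) => [hi|//].
case: (boolP ((j == a) || (j == b))) => [hj|//].
case/orP: hi => /eqP hi; case/orP: hj => /eqP hj; move: nab ij;
  rewrite hi hj /near /far; lia.
Qed.

Lemma cyclic_comm_cyc_equiv x y : cyclic_comm_equiv x y -> uniq x ->
  cyc_equiv (heap x) (heap y).
Proof.
elim=> {x y} [x y xy ux|x _|x y xy IH uy|x z y xz IH1 _ IH2 ux].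
- have uy : uniq y by rewrite -(perm_uniq (cyclic_equiv_perm (rst_step _ _ _ _ xy))).
  apply: rst_step; case: xy => [xy|[i [u [xE yE]]]]; [left|right].
    apply: models_lposet_iso (models_heap ux) (models_heap uy) _ _.
      exact/perm_mem/comm_equiv_perm/rt_step.
    by case: xy => u v _ _ [i j ij]; apply: label_step_comm.
  exists (word_prod x), i, u; rewrite -xE -yE; split.
  + exact: uniq_CFC.
  + exact: uniq_reduced.
  + exact: lposet_iso_refl.
  + exact: lposet_iso_refl.
- exact: rst_refl.
- by apply/rst_sym/IH; rewrite (perm_uniq (cyclic_equiv_perm xy)).
- by apply: rst_trans (IH1 ux) (IH2 _); rewrite -(perm_uniq (cyclic_equiv_perm xz)).
Qed.

Lemma label_ring_cyc_equiv I H K : label_ring I H -> label_ring I K -> cyc_equiv H K.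
Proof.
case=> z zI mH [z' z'I mK]; have [uz _ _ _] := mH; have [uz' _ _ _] := mK.
have zz' : perm_eq z z'.
  by apply: uniq_perm => // i; move/setP/(_ i): zI; rewrite -z'I !inE.
apply: (@rst_trans _ _ _ (heap z)).
  by apply: rst_step; left; apply/heap_iso_models.
apply: (@rst_trans _ _ _ (heap z')).
  exact: cyclic_comm_cyc_equiv (uniq_cyclic_equiv uz zz') uz.
by apply: rst_step; left; apply/lposet_iso_sym/heap_iso_models.
Qed.

Lemma ring_of_label_ring I C : label_ring I C -> ring_of C = label_ring I.
Proof.
move=> CI; apply/funext => D; apply/propext; split=> [CD|]; last exact: label_ring_cyc_equiv.
by apply/(cyc_equiv_label_ring I CD).
Qed.

Lemma cyl_heap_label_ring x : uniq x -> cyl_heap (word_prod x) = label_ring [set i in x].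
Proof.
move=> ux; apply/funext => H; apply/propext; split=> [[H0 [x' [rx' HH]] H0H]|HR].
  apply/(cyc_equiv_label_ring _ H0H).
  have [ux' xx'] := reduced_uniq ux rx'; exists x'; last exact/heap_iso_models.
  by apply/setP => i; rewrite !inE (perm_mem xx').
exists (heap x); first by exists x; split; [apply: uniq_reduced|apply: lposet_iso_refl].
exact: label_ring_cyc_equiv (label_ring_heap ux) HR.
Qed.

(** Induction on the size of the interval: if [b] does not cover [a], a block strictly between them
    splits it into two smaller intervals. *)
Lemma hle_connect H (a b : H) : hle a b -> connect (fun c d => covers c d || covers d c) a b.
Proof.
have [m] := ubnP #|[set c | hle a c && hle c b]|; elim: m a b => // m IH a b card_ab ab.
have [->|ne_ab] := eqVneq a b; first exact: connect0.
have [cov|/nandP] := boolP (covers a b); first by apply: connect1; rewrite cov.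
rewrite ne_ab ab /= => -[//|/forallPn[c]]; rewrite negb_imply negb_or.
case/andP=> /andP[ac cb] /andP[ca cb'].
apply: (@connect_trans _ _ c); apply: IH => //; apply: leq_trans (proper_card _) card_ab.
  apply/properP; split.
    by apply/subsetP => d; rewrite !inE => /andP[->] /hle_trans; apply.
  exists b; rewrite !inE ?ab ?hle_refl //=.
  by apply: contra cb' => bc; apply/eqP/hle_anti; rewrite cb.
apply/properP; split.
  by apply/subsetP => d; rewrite !inE => /andP[cd ->]; rewrite (hle_trans ac cd).
exists a; rewrite !inE ?ab ?hle_refl ?andbT //=.
by apply: contra ca => ca'; apply/eqP/hle_anti; rewrite ca'.
Qed.

Lemma component_convex H (a : H) : convex (component a).
Proof.
move=> b c d; rewrite !inE => ab _ /hle_connect bc _; exact: connect_trans ab bc.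
Qed.

(** * Chunks correspond to runs *)

Section Chunks.
Variables (H : lposet n) (z : seq 'I_n).
Hypothesis mH : models H z.
Let S := [set i in z].

(** Comparable blocks are joined by a chain of adjacent labels in the support; conversely, blocks
    with adjacent labels are comparable, hence joined by covers. *)
Lemma mem_component (a b : H) : (b \in component a) = (hlabel b \in run S (hlabel a)).
Proof.
have [_ Hinj Hlab Hle] := mH; rewrite !inE; apply/idP/idP.
  have hle_near (c d : H) : hle c d -> connect (near_in S) (hlabel c) (hlabel d).
    rewrite Hle; apply: connect_sub => i j ij; apply: connect1.
    have /andP[iz jz] := label_step_mem ij.
    by case/andP: ij => nij _; rewrite /near_in !inE iz jz.
  apply: connect_map => c d /orP[] /and3P[_ cd _]; first exact: hle_near.
  by rewrite (sym_connect_sym (near_in_sym S)) hle_near.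
apply: connect_lift => // c l /and3P[cS]; rewrite inE => /Hlab[d <-] cd; exists d => //.
have cdne : hlabel c != hlabel d by apply: contraTneq cd => ->; rewrite /near; lia.
have Sc : hlabel c \in z by apply/Hlab; exists c.
have Sd : hlabel d \in z by apply/Hlab; exists d.
have [le_cd|le_dc] : hle c d \/ hle d c; last 2 first.
- exact: hle_connect.
- by rewrite sym_connect_sym ?hle_connect // => e f; rewrite orbC.
have uz : uniq z by case: mH.
have hc := nth_index (hlabel c) Sc; have hd := nth_index (hlabel c) Sd.
have icd : index (hlabel c) z != index (hlabel d) z.
  by apply: contraNneq cdne => e; rewrite -{1}hc e hd.
rewrite !Hle; case: (ltngtP (index (hlabel c) z) (index (hlabel d) z)) icd => // lt_i _.
  right; apply/connect1; rewrite /label_step nearC cd -{1}hc -{1}hd.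
  by rewrite subseq_pair ?index_mem // ltn_eqF.
left; apply/connect1; rewrite /label_step cd -{1}hd -{2}hc.
by rewrite subseq_pair ?index_mem // ltn_eqF.
Qed.

(** A chain of label steps that starts in a run never leaves it, so restricting the word to the run
    does not change the order there. *)
Lemma models_component (a : H) :
  models (subheap (component a)) (filter (mem (run S (hlabel a))) z).
Proof.
have [uz Hinj Hlab Hle] := mH; split=> [||i|b c].
- exact: filter_uniq.
- by move=> b c /Hinj/enum_val_inj.
- rewrite mem_filter; split=> [/andP[/= iI /Hlab[b bi]]|[b <-]].
    have bA : b \in component a by rewrite mem_component bi.
    by exists (enum_rank_in bA b); rewrite /= enum_rankK_in.
  have bA := enum_valP b; rewrite /= -mem_component bA /=.
  by apply/Hlab; exists (enum_val b).
have stepE i j : label_step [seq l <- z | l \in run S (hlabel a)] i j =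
    [&& i \in run S (hlabel a), j \in run S (hlabel a) & label_step z i j].
  by rewrite /label_step subseq_filter /= andbT; do !case: (_ \in _); case: near.
rewrite [LHS]Hle; apply/idP/idP.
  apply: (connect_restrict (P := mem (run S (hlabel a)))); last first.
    by rewrite /= -mem_component; apply: enum_valP.
  move=> i j /= iI ij; have jI : j \in run S (hlabel a).
    have /andP[iz jz] := label_step_mem ij; move: iI; rewrite !inE => /connect_trans; apply.
    by apply: connect1; rewrite /near_in !inE iz jz; case/andP: ij.
  by rewrite stepE iI jI ij.
by apply: connect_sub => i j; rewrite stepE => /and3P[_ _]; apply: connect1.
Qed.

Lemma chunk_rings (R : classical_sets.set (lposet n)) :
  (exists2 C, chunk H C & R = ring_of C) <-> exists2 I, I \in runs S & R = label_ring I.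
Proof.
have [_ _ Hlab _] := mH.
have component_ring (a : H) : label_ring (run S (hlabel a)) (subheap (component a)).
  exists (filter (mem (run S (hlabel a))) z); last exact: models_component.
  apply/setP => i; rewrite inE mem_filter /=; apply/andb_idr => ir.
  have aS : hlabel a \in S by rewrite inE; apply/Hlab; exists a.
  by have := subsetP (run_sub aS) _ ir; rewrite inE.
split=> [[C [A [_ [a ->] CA]] ->]|[_ /imsetP[i iS ->] ->]].
  exists (run S (hlabel a)); first by apply: imset_f; rewrite inE; apply/Hlab; exists a.
  apply: ring_of_label_ring; have [z' z'I mC] := component_ring a.
  by exists z' => //; apply: models_iso CA mC.
move: iS; rewrite inE => /Hlab[a <-].
exists (subheap (component a)); last by rewrite (ring_of_label_ring (component_ring a)).
exists (component a); split; [exact: component_convex|by exists a|exact: lposet_iso_refl].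
Qed.

End Chunks.

(** * Ring equivalence in terms of runs *)

Lemma rings_cyl_heap x (R : classical_sets.set (lposet n)) : uniq x ->
  rings (cyl_heap (word_prod x)) R <-> exists2 I, I \in runs [set i in x] & R = label_ring I.
Proof.
move=> ux; rewrite cyl_heap_label_ring //; split.
  case=> H [C [[z zx mH] HC RE]]; rewrite -zx; apply/(chunk_rings mH); by exists C.
have mx := models_heap ux; move/(chunk_rings mx) => [C HC ->].
by exists (heap x), C; split=> //; apply: label_ring_heap.
Qed.

(** Since [label_ring] is injective and its members have as many blocks as labels, bijections of
    rings preserving size amount to bijections of runs preserving size, which [size_count_map] turns
    into equal counts. *)
Lemma ring_equivalent_runs x y : uniq x -> uniq y ->
  ring_equivalent (cyl_heap (word_prod x)) (cyl_heap (word_prod y)) <->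
  forall m, size_count (runs [set i in x]) m = size_count (runs [set i in y]) m.
Proof.
move=> ux uy; set A := runs _; set B := runs _.
have ringsA R := rings_cyl_heap R ux; have ringsB R := rings_cyl_heap R uy.
set K := cyl_heap _ in ringsA *; set K' := cyl_heap _ in ringsB *.
have inA I : I \in A -> rings K (label_ring I) by move=> AI; apply/ringsA; exists I.
have inB I : I \in B -> rings K' (label_ring I) by move=> BI; apply/ringsB; exists I.
(* A left inverse of [label_ring], defined on arbitrary sets of heaps by collecting all labels that
   occur. *)
pose labels (R : classical_sets.set (lposet n)) : {set 'I_n} :=
  [set i | `[< exists2 H, R H & exists a : H, hlabel a = i >]].
have labelsK I : labels (label_ring I) = I.
  apply/setP => i; rewrite inE; apply/asboolP/idP.
    by case=> H /label_ring_labels <- [a <-]; apply: imset_f.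
  move=> iI; exists (heap (enum I)); first exact: label_ring_enum.
  move: iI; rewrite -{1}(label_ring_labels (label_ring_enum I)).
  by case/imsetP => a _ ->; exists a.
split=> [[f [[f_fun f_inj f_surj] f_size]]|/size_count_map[phi [phi_inj phi_im phi_card]]].
  have fE I : I \in A -> exists2 J, J \in B & f (label_ring I) = label_ring J.
    by move=> /inA/f_fun/ringsB.
  have phiE I : I \in A -> f (label_ring I) = label_ring (labels (f (label_ring I))).
    by case/fE => J _ ->; rewrite labelsK.
  apply/size_count_map; exists (fun I => labels (f (label_ring I))); split.
  - move=> I J AI AJ e; apply: label_ring_inj; apply: f_inj; last by rewrite (phiE _ AI) (phiE _ AJ) e.
    + by apply/classical_sets.mem_set/inA.
    + by apply/classical_sets.mem_set/inA.
  - apply/setP => J; apply/imsetP/idP => [[I /fE[J' BJ' e] ->]|BJ].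
      by rewrite e labelsK.
    have [R /ringsA[I AI ->] e] := f_surj _ (inB _ BJ).
    by exists I => //; rewrite e labelsK.
  - move=> I AI; have := f_size _ (inA _ AI) _ _ (label_ring_enum I).
    rewrite (phiE _ AI) => /(_ _ (label_ring_enum _)).
    by rewrite !(label_ring_card (label_ring_enum _)) labelsK.
exists (fun R => label_ring (phi (labels R))); split.
  split.
  - by move=> R /ringsA[I AI ->]; apply: inB; rewrite labelsK -phi_im imset_f.
  - move=> R R' /classical_sets.set_mem/ringsA[I AI ->] /classical_sets.set_mem/ringsA[J AJ ->].
    by rewrite !labelsK => /label_ring_inj/phi_inj ->.
  - move=> R /ringsB[J]; rewrite -/B -phi_im => /imsetP[I AI ->] ->.
    by exists (label_ring I); [apply: inA|rewrite labelsK].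
move=> R /ringsA[I AI ->] C D; rewrite labelsK => /label_ring_card -> /label_ring_card ->.
by rewrite phi_card.
Qed.

End Heaps.

Theorem theorem3p2p1 (n : nat) (w y : cox n) (hw : CFC w) (hy : CFC y) :
  conjugate w y <-> ring_equivalent (cyl_heap w) (cyl_heap y).
Proof.
have [x ux ->] := CFC_word hw; have [z uz ->] := CFC_word hy.
by rewrite conjugate_runs // ring_equivalent_runs.
Qed.
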